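(* For every $n \geq 0$ there is a bijection between the set of complementary triples $(S,D,p)$ in $T_n$ and the set of elements of the free mirig $R_n$ on $n$ generators.
   Context: A mirig is a rig (semiring with $0$ and $1$, addition commutative, multiplication not assumed commutative, $0$ absorbing for multiplication) in which $x^2 = x$ for all $x$. $R_n$ denotes the free mirig on an $n$-element set $[n]$ of generators, i.e. the quotient of the free (noncommutative) rig on $[n]$ by the congruence generated by $r \approx r^2$ for all elements $r$. Trees. $F_n$ is the free monoid (words) on $[n]$; $\sim$ is the congruence on $F_n$ generated by $w \sim ww$ for all words $w$; $M_n = F_n/{\sim}$ is the free idempotent monoid on $[n]$. The set $T_n$ of trees and the alphabet map $\alpha : T_n \to \mathcal{P}([n])$ (power set) are defined inductively: the trivial tree $()$ is in $T_n$ with $\alpha(()) = \emptyset$; if $t_0,t_1 \in T_n$, $a_0 \in [n]\setminus\alpha(t_0)$, $a_1 \in [n]\setminus\alpha(t_1)$ and $\alpha(t_0)\cup\{a_0\} = \{a_1\}\cup\alpha(t_1)$, then $t=(t_0,a_0,a_1,t_1) \in T_n$ with $\alpha(t) = \alpha(t_0)\cup\{a_0\}$. For a word $w$, $\alpha(w)$ is its set of letters. The map $\mathrm{tr}: F_n \to T_n$ sends the empty word to $()$ and a non-empty word $w$ to $(\mathrm{tr}(p),a,b,\mathrm{tr}(q))$, where $p$ is the maximal prefix of $w$ containing all but one of the generators in $\alpha(w)$, $a$ is the sole element of $\alpha(w)\setminus\alpha(p)$, $q$ is the maximal suffix of $w$ containing all but one of the generators in $\alpha(w)$, and $b$ is the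 sole element of $\alpha(w)\setminus\alpha(q)$. The map $\mathrm{tr}$ is surjective and $\mathrm{tr}(w)=\mathrm{tr}(w')$ iff $w\sim w'$, so $T_n$ carries a unique monoid structure (written by juxtaposition, identity $()$) making $\mathrm{tr}$ a homomorphism; thus $T_n \cong M_n$. Subsemigroups. A subsemigroup of $T_n$ is a (possibly empty) subset closed under products. For $U\subseteq T_n$ and $x,y\in T_n$, $x\backslash U/y := \{t \in T_n \mid xty \in U\}$. A subsemigroup $S$ is replete if $x\backslash S/y$ is a subsemigroup for all $x,y\in T_n$. For $U \subseteq T_n$, $\bar{\alpha}(U) := \{\alpha(t)\mid t\in U\} \subseteq \mathcal{P}([n])$. Complementary triples. A set $D\subseteq T_n$ is sparse if whenever $s,t\in D$ satisfy $\alpha(s)\subseteq\alpha(t)$ we have $s=t$. A replete subsemigroup $S$ dominates a sparse set $D$ if (i) $\bar\alpha(D)\cap\bar\alpha(S)=\emptyset$, (ii) $D\cup S$ is a subsemigroup of $T_n$, and (iii) $\alpha(t)$ is minimal (under inclusion) in $\bar\alpha(D\cup S)$ for each $t\in D$. If $S$ dominates $D$, a parity function for $(S,D)$ is a function $p:\mathcal{P}([n])\to\{0,1\}$ such that $p(A)=1$ for all $A\in\bar\alpha(D)$, and $p(A)=1$ implies $A\in\bar\alpha(S\cup D)$. A complementary triple in $T_n$ is a triple $(S,D,p)$ with $S$ a replete subsemigroup of $T_n$, $D$ a sparse subset of $T_n$ dominated by $S$, and $p$ a parity function for $(S,D)$. *)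

(* Defs.v *)
From HB Require Import structures.
From mathcomp Require Import all_boot ssralg generic_quotient.
From mathcomp Require Import boolp.
From mathcomp Require classical_sets functions.

Set Implicit Arguments.
Unset Strict Implicit.
Unset Printing Implicit Defensive.

Import GRing.Theory.

(* Free algebras are built as terms modulo the congruence generated by the
   axioms; a rig is a [pzSemiRingType], in which [1 = 0] is allowed. *)

Inductive rig_term (n : nat) : Type :=
| RGen of 'I_n
| RZero
| ROne
| RAdd of rig_term n & rig_term n
| RMul of rig_term n & rig_term n.

Arguments RZero {n}.
Arguments ROne {n}.

HB.instance Definition _ n := gen_eqMixin (rig_term n).
HB.instance Definition _ n := gen_choiceMixin (rig_term n).

Inductive rig_eq (n : nat) : rig_term n -> rig_term n -> Prop :=
| rig_refl x : rig_eq x x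
| rig_sym x y : rig_eq x y -> rig_eq y x
| rig_trans x y z : rig_eq x y -> rig_eq y z -> rig_eq x z
| rig_congD x x' y y' :
    rig_eq x x' -> rig_eq y y' -> rig_eq (RAdd x y) (RAdd x' y')
| rig_congM x x' y y' :
    rig_eq x x' -> rig_eq y y' -> rig_eq (RMul x y) (RMul x' y')
| rig_addA x y z : rig_eq (RAdd x (RAdd y z)) (RAdd (RAdd x y) z)
| rig_addC x y : rig_eq (RAdd x y) (RAdd y x)
| rig_add0 x : rig_eq (RAdd RZero x) x
| rig_mulA x y z : rig_eq (RMul x (RMul y z)) (RMul (RMul x y) z)
| rig_mul1l x : rig_eq (RMul ROne x) x
| rig_mul1r x : rig_eq (RMul x ROne) x
| rig_mulDl x y z : rig_eq (RMul (RAdd x y) z) (RAdd (RMul x z) (RMul y z))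
| rig_mulDr x y z : rig_eq (RMul x (RAdd y z)) (RAdd (RMul x y) (RMul x z))
| rig_mul0l x : rig_eq (RMul RZero x) RZero
| rig_mul0r x : rig_eq (RMul x RZero) RZero.

Definition rig_eqb (n : nat) : rel (rig_term n) := fun x y => `[< rig_eq x y >].

Lemma rig_eqb_refl n : reflexive (@rig_eqb n).
Proof. by move=> x; apply/asboolP/rig_refl. Qed.

Lemma rig_eqb_sym n : symmetric (@rig_eqb n).
Proof. by move=> x y; apply/asboolP/asboolP => /rig_sym. Qed.

Lemma rig_eqb_trans n : transitive (@rig_eqb n).
Proof.
by move=> y x z /asboolP xy /asboolP yz; apply/asboolP/(rig_trans xy yz).
Qed.

Canonical rig_equiv n :=
  EquivRel (@rig_eqb n) (@rig_eqb_refl n) (@rig_eqb_sym n) (@rig_eqb_trans n).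

Local Open Scope quotient_scope.

Definition free_rig (n : nat) : Type := {eq_quot (@rig_eqb n)}.

HB.instance Definition _ n := Choice.on (free_rig n).
HB.instance Definition _ n := EqQuotient.on (free_rig n).

Section FreeRig.
Variable n : nat.
Implicit Types (s t : rig_term n) (x y z : free_rig n).

Lemma rig_eqP s t : rig_eq s t <-> \pi_(free_rig n) s = \pi_(free_rig n) t.
Proof.
split=> [st | /eqmodP /asboolP //].
by apply/eqmodP/asboolP.
Qed.

Definition frig_add x y : free_rig n := \pi_(free_rig n) (RAdd (repr x) (repr y)).
Definition frig_mul x y : free_rig n := \pi_(free_rig n) (RMul (repr x) (repr y)).

Lemma repr_pi_rig s : rig_eq (repr (\pi_(free_rig n) s)) s.
Proof. by apply/rig_eqP; rewrite reprK. Qed.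

Lemma frig_addE s t :
  frig_add (\pi s) (\pi t) = \pi_(free_rig n) (RAdd s t).
Proof. by apply/rig_eqP/rig_congD; apply: repr_pi_rig. Qed.

Lemma frig_mulE s t :
  frig_mul (\pi s) (\pi t) = \pi_(free_rig n) (RMul s t).
Proof. by apply/rig_eqP/rig_congM; apply: repr_pi_rig. Qed.

Let zero : free_rig n := \pi_(free_rig n) RZero.
Let one : free_rig n := \pi_(free_rig n) ROne.

Fact frig_addA : associative frig_add.
Proof.
elim/quotW=> x; elim/quotW=> y; elim/quotW=> z.
by rewrite !frig_addE; apply/rig_eqP/rig_addA.
Qed.

Fact frig_addC : commutative frig_add.
Proof.
by elim/quotW=> x; elim/quotW=> y; rewrite !frig_addE; apply/rig_eqP/rig_addC.
Qed.

Fact frig_add0 : left_id zero frig_add.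
Proof. by elim/quotW=> x; rewrite frig_addE; apply/rig_eqP/rig_add0. Qed.

Fact frig_mulA : associative frig_mul.
Proof.
elim/quotW=> x; elim/quotW=> y; elim/quotW=> z.
by rewrite !frig_mulE; apply/rig_eqP/rig_mulA.
Qed.

Fact frig_mul1l : left_id one frig_mul.
Proof. by elim/quotW=> x; rewrite frig_mulE; apply/rig_eqP/rig_mul1l. Qed.

Fact frig_mul1r : right_id one frig_mul.
Proof. by elim/quotW=> x; rewrite frig_mulE; apply/rig_eqP/rig_mul1r. Qed.

Fact frig_mulDl : left_distributive frig_mul frig_add.
Proof.
elim/quotW=> x; elim/quotW=> y; elim/quotW=> z.
by rewrite !(frig_addE, frig_mulE); apply/rig_eqP/rig_mulDl.
Qed.

Fact frig_mulDr : right_distributive frig_mul frig_add.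
Proof.
elim/quotW=> x; elim/quotW=> y; elim/quotW=> z.
by rewrite !(frig_addE, frig_mulE); apply/rig_eqP/rig_mulDr.
Qed.

Fact frig_mul0l : left_zero zero frig_mul.
Proof. by elim/quotW=> x; rewrite frig_mulE; apply/rig_eqP/rig_mul0l. Qed.

Fact frig_mul0r : right_zero zero frig_mul.
Proof. by elim/quotW=> x; rewrite frig_mulE; apply/rig_eqP/rig_mul0r. Qed.

HB.instance Definition _ := GRing.isPzSemiRing.Build (free_rig n)
  frig_addA frig_addC frig_add0 frig_mulA frig_mul1l frig_mul1r
  frig_mulDl frig_mulDr frig_mul0l frig_mul0r.

End FreeRig.

Inductive mirig_cong (n : nat) : free_rig n -> free_rig n -> Prop :=
| mirig_idem r : mirig_cong r (r * r)%R
| mirig_refl x : mirig_cong x x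
| mirig_sym x y : mirig_cong x y -> mirig_cong y x
| mirig_trans x y z : mirig_cong x y -> mirig_cong y z -> mirig_cong x z
| mirig_congD x x' y y' :
    mirig_cong x x' -> mirig_cong y y' -> mirig_cong (x + y)%R (x' + y')%R
| mirig_congM x x' y y' :
    mirig_cong x x' -> mirig_cong y y' -> mirig_cong (x * y)%R (x' * y')%R.

Definition mirig_congb (n : nat) : rel (free_rig n) :=
  fun x y => `[< mirig_cong x y >].

Lemma mirig_congb_refl n : reflexive (@mirig_congb n).
Proof. by move=> x; apply/asboolP/mirig_refl. Qed.

Lemma mirig_congb_sym n : symmetric (@mirig_congb n).
Proof. by move=> x y; apply/asboolP/asboolP => /mirig_sym. Qed.

Lemma mirig_congb_trans n : transitive (@mirig_congb n).
Proof.
by move=> y x z /asboolP xy /asboolP yz; apply/asboolP/(mirig_trans xy yz).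
Qed.

Canonical mirig_equiv n :=
  EquivRel (@mirig_congb n) (@mirig_congb_refl n) (@mirig_congb_sym n)
           (@mirig_congb_trans n).

Definition free_mirig (n : nat) : Type := {eq_quot (@mirig_congb n)}.

HB.instance Definition _ n := Choice.on (free_mirig n).
HB.instance Definition _ n := EqQuotient.on (free_mirig n).

Section FreeMirig.
Local Open Scope ring_scope.
Variable n : nat.
Implicit Types (s t : free_rig n) (x y z : free_mirig n).

Lemma mirig_congP s t :
  mirig_cong s t <-> \pi_(free_mirig n) s = \pi_(free_mirig n) t.
Proof.
split=> [st | /eqmodP /asboolP //].
by apply/eqmodP/asboolP.
Qed.

Definition mirig_add x y : free_mirig n := \pi_(free_mirig n) (repr x + repr y).
Definition mirig_mul x y : free_mirig n := \pi_(free_mirig n) (repr x * repr y).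

Lemma repr_pi_mirig s : mirig_cong (repr (\pi_(free_mirig n) s)) s.
Proof. by apply/mirig_congP; rewrite reprK. Qed.

Lemma mirig_addE s t : mirig_add (\pi s) (\pi t) = \pi_(free_mirig n) (s + t).
Proof. by apply/mirig_congP/mirig_congD; apply: repr_pi_mirig. Qed.

Lemma mirig_mulE s t : mirig_mul (\pi s) (\pi t) = \pi_(free_mirig n) (s * t).
Proof. by apply/mirig_congP/mirig_congM; apply: repr_pi_mirig. Qed.

Let zero : free_mirig n := \pi_(free_mirig n) 0.
Let one : free_mirig n := \pi_(free_mirig n) 1.

Fact mirig_addA : associative mirig_add.
Proof.
elim/quotW=> x; elim/quotW=> y; elim/quotW=> z.
by rewrite !mirig_addE addrA.
Qed.

Fact mirig_addC : commutative mirig_add.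
Proof. by elim/quotW=> x; elim/quotW=> y; rewrite !mirig_addE addrC. Qed.

Fact mirig_add0 : left_id zero mirig_add.
Proof. by elim/quotW=> x; rewrite mirig_addE add0r. Qed.

Fact mirig_mulA : associative mirig_mul.
Proof.
elim/quotW=> x; elim/quotW=> y; elim/quotW=> z.
by rewrite !mirig_mulE mulrA.
Qed.

Fact mirig_mul1l : left_id one mirig_mul.
Proof. by elim/quotW=> x; rewrite mirig_mulE mul1r. Qed.

Fact mirig_mul1r : right_id one mirig_mul.
Proof. by elim/quotW=> x; rewrite mirig_mulE mulr1. Qed.

Fact mirig_mulDl : left_distributive mirig_mul mirig_add.
Proof.
elim/quotW=> x; elim/quotW=> y; elim/quotW=> z.
by rewrite !(mirig_addE, mirig_mulE) mulrDl.
Qed.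

Fact mirig_mulDr : right_distributive mirig_mul mirig_add.
Proof.
elim/quotW=> x; elim/quotW=> y; elim/quotW=> z.
by rewrite !(mirig_addE, mirig_mulE) mulrDr.
Qed.

Fact mirig_mul0l : left_zero zero mirig_mul.
Proof. by elim/quotW=> x; rewrite mirig_mulE mul0r. Qed.

Fact mirig_mul0r : right_zero zero mirig_mul.
Proof. by elim/quotW=> x; rewrite mirig_mulE mulr0. Qed.

HB.instance Definition _ := GRing.isPzSemiRing.Build (free_mirig n)
  mirig_addA mirig_addC mirig_add0 mirig_mulA mirig_mul1l mirig_mul1r
  mirig_mulDl mirig_mulDr mirig_mul0l mirig_mul0r.

Lemma mirig_mulxx x : x * x = x.
Proof.
elim/quotW: x => x; rewrite -[LHS]/(mirig_mul _ _) mirig_mulE.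
exact/esym/mirig_congP/mirig_idem.
Qed.

End FreeMirig.

Local Close Scope quotient_scope.

Inductive raw_tree (n : nat) : Type :=
| Leaf
| Node of raw_tree n & 'I_n & 'I_n & raw_tree n.

Arguments Leaf {n}.

HB.instance Definition _ n := gen_eqMixin (raw_tree n).
HB.instance Definition _ n := gen_choiceMixin (raw_tree n).

Fixpoint raw_alpha (n : nat) (t : raw_tree n) : {set 'I_n} :=
  if t is Node t0 a0 _ _ then a0 |: raw_alpha t0 else set0.

Fixpoint is_tree (n : nat) (t : raw_tree n) : bool :=
  if t is Node t0 a0 a1 t1 then
    [&& is_tree t0, is_tree t1, a0 \notin raw_alpha t0, a1 \notin raw_alpha t1
      & a0 |: raw_alpha t0 == a1 |: raw_alpha t1]
  else true.

Record tree (n : nat) : Type := Tree { rtree :> raw_tree n; _ : is_tree rtree }.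

HB.instance Definition _ n := [isSub for @rtree n].
HB.instance Definition _ n := [Choice of tree n by <:].

Definition alpha (n : nat) (t : tree n) : {set 'I_n} := raw_alpha t.

Definition letters (n : nat) (w : seq 'I_n) : {set 'I_n} := [set x in w].

(* For nonempty [w], the maximal prefix (resp. suffix) of [w] containing all but
   one of the letters of [w]. *)
Definition lpart (n : nat) (w : seq 'I_n) : seq 'I_n :=
  take (\max_(k < (size w).+1 | #|letters (take k w)|.+1 == #|letters w|) k) w.

Definition rpart (n : nat) (w : seq 'I_n) : seq 'I_n := rev (lpart (rev w)).

(* [k] is the number of letters of [w]; the [Leaf] of the inner match is then
   unreachable (see [raw_tr_split]). *)
Fixpoint raw_tr_rec (n k : nat) (w : seq 'I_n) : raw_tree n :=
  if k is k'.+1 then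
    match [pick a in letters w :\: letters (lpart w)],
          [pick b in letters w :\: letters (rpart w)] with
    | Some a, Some b =>
        Node (raw_tr_rec k' (lpart w)) a b (raw_tr_rec k' (rpart w))
    | _, _ => Leaf
    end
  else Leaf.

Definition raw_tr (n : nat) (w : seq 'I_n) : raw_tree n :=
  raw_tr_rec #|letters w| w.

Section Tr.
Local Open Scope nat_scope.
Variable n : nat.
Implicit Types (u v w p q x y : seq 'I_n) (a b : 'I_n) (s t : raw_tree n).

Lemma letters_nil : letters [::] = set0 :> {set 'I_n}.
Proof. by apply/setP=> i; rewrite !inE. Qed.

Lemma letters_cons a w : letters (a :: w) = a |: letters w.
Proof. by apply/setP=> i; rewrite !inE. Qed.

Lemma letters_cat u v : letters (u ++ v) = letters u :|: letters v.
Proof. by apply/setP=> i; rewrite !inE mem_cat. Qed.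

Lemma letters_rev w : letters (rev w) = letters w.
Proof. by apply/setP=> i; rewrite !inE mem_rev. Qed.

Lemma in_letters a w : (a \in letters w) = (a \in w).
Proof. by rewrite inE. Qed.

Definition lsplit w p a x :=
  [/\ w = p ++ a :: x, a \notin letters p & letters w = a |: letters p].

Lemma lsplit_ex w : w != [::] -> exists p a x, lsplit w p a x.
Proof.
elim/last_ind: w => // w b IH _.
have Eb : letters (rcons w b) = b |: letters w.
  by apply/setP=> i; rewrite !inE mem_rcons inE.
have [bw|bw] := boolP (b \in letters w); last first.
  by exists w, b, [::]; split; rewrite // cats1.
have /IH [p [a [x [E ap Ew]]]] : w != [::] by case: (w) bw; rewrite ?inE.
exists p, a, (rcons x b); split=> //; first by rewrite E rcons_cat.
by rewrite Eb -Ew; apply/setUidPr; rewrite sub1set.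
Qed.

Lemma lsplit_card w p a x : lsplit w p a x -> #|letters w| = #|letters p|.+1.
Proof. by case=> _ ap ->; rewrite cardsU1 ap. Qed.

Lemma lsplit_lpart w p a x : lsplit w p a x -> lpart w = p.
Proof.
move=> spl; have [E ap Ew] := spl; rewrite /lpart.
suff -> : \max_(k < (size w).+1 | #|letters (take k w)|.+1 == #|letters w|) k
          = size p :> nat by rewrite E take_size_cat.
have szp : size p < (size w).+1 by rewrite E size_cat ltnS leq_addr.
apply/eqP; rewrite eqn_leq; apply/andP; split; last first.
  rewrite -[size p]/(nat_of_ord (Ordinal szp)).
  by apply: leq_bigmax_cond; rewrite /= (lsplit_card spl) E take_size_cat.
apply/bigmax_leqP=> -[k /= _] /eqP Ek; rewrite leqNgt; apply/negP=> ltk.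
suff sub : letters w \subset letters (take k w).
  by have := subset_leq_card sub; rewrite -Ek ltnn.
rewrite Ew E take_cat ltnNge ltnW //= letters_cat setUC setUS // sub1set inE.
by rewrite -[k - size p]prednK ?subn_gt0 //= inE eqxx.
Qed.

Lemma lsplit_pick w p a x : lsplit w p a x ->
  [pick c in letters w :\: letters (lpart w)] = Some a.
Proof.
move=> spl; rewrite (lsplit_lpart spl); case: spl => _ ap ->.
case: pickP => [c|/(_ a)]; rewrite in_setD in_setU1; last by rewrite ap eqxx.
by case/andP=> /negPf->; rewrite orbF => /eqP->.
Qed.

Definition rsplit w x b q := lsplit (rev w) (rev q) b (rev x).

Lemma rsplit_ex w : w != [::] -> exists x b q, rsplit w x b q.
Proof.
rewrite -size_eq0 -size_rev size_eq0 => /lsplit_ex [p [a [x spl]]].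
by exists (rev x), a, (rev p); rewrite /rsplit !revK.
Qed.

Lemma rsplitP w x b q : rsplit w x b q <->
  [/\ w = x ++ b :: q, b \notin letters q & letters w = b |: letters q].
Proof.
rewrite /rsplit /lsplit !letters_rev; split=> [[E]|[->]]; split=> //.
  by rewrite -[w]revK E rev_cat rev_cons !revK cat_rcons.
by rewrite rev_cat rev_cons cat_rcons.
Qed.

Lemma raw_tr_nil : raw_tr [::] = Leaf :> raw_tree n.
Proof. by rewrite /raw_tr letters_nil cards0. Qed.

Lemma raw_tr_split w p a x y b q : lsplit w p a x -> rsplit w y b q ->
  raw_tr w = Node (raw_tr p) a b (raw_tr q).
Proof.
move=> spl spr; rewrite /raw_tr (lsplit_card spl) /= (lsplit_pick spl).
have := lsplit_card spr; rewrite !letters_rev (lsplit_card spl) => -[->].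
rewrite /rpart -(letters_rev w) !letters_rev (lsplit_lpart spl).
rewrite (lsplit_lpart spr) revK.
have := lsplit_pick spr; rewrite (lsplit_lpart spr) !letters_rev => ->.
by [].
Qed.

Lemma raw_trP w :
  is_tree (raw_tr w) /\ raw_alpha (raw_tr w) = letters w.
Proof.
have [k] := ubnP #|letters w|; elim: k w => // k IH w lek.
have [-> | /[dup] /lsplit_ex [p [a [x spl]]] /rsplit_ex [y [b [q spr]]]] :=
  eqVneq w [::]; first by rewrite raw_tr_nil letters_nil.
rewrite (raw_tr_split spl spr) /=.
have cw := lsplit_card spl; have cw' := lsplit_card spr.
rewrite !letters_rev in cw'.
have [] := IH p; first by rewrite -ltnS -cw.
have [] := IH q; first by rewrite -ltnS -cw'.
move=> -> Eq -> Ep; rewrite Ep Eq.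
have [_ ap Ew] := spl; have /rsplitP [_ bq Ew'] := spr.
by rewrite ap bq /= -Ew -Ew' eqxx.
Qed.

Definition tr w : tree n := Tree (raw_trP w).1.

Lemma alpha_tr w : alpha (tr w) = letters w.
Proof. exact: (raw_trP w).2. Qed.

Fixpoint raw_word t : seq 'I_n :=
  if t is Node t0 a0 a1 t1 then raw_word t0 ++ a0 :: a1 :: raw_word t1
  else [::].

Lemma raw_wordK t : is_tree t -> raw_tr (raw_word t) = t.
Proof.
elim: t => [_|t0 IH0 a0 a1 t1 IH1 /=]; first exact: raw_tr_nil.
case/and5P=> /IH0 E0 /IH1 E1.
have := (raw_trP (raw_word t0)).2; have := (raw_trP (raw_word t1)).2.
rewrite E0 E1 => -> -> a0N a1N /eqP E.
rewrite -[in RHS]E0 -[in RHS]E1.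
have Ew : letters (raw_word t0 ++ [:: a0, a1 & raw_word t1])
          = a0 |: letters (raw_word t0).
  rewrite letters_cat !letters_cons -E.
  by apply/setP=> i; rewrite !in_setU; do !case: (i \in _).
apply: (@raw_tr_split _ _ _ (a1 :: raw_word t1) (rcons (raw_word t0) a0)).
  by split.
by apply/rsplitP; rewrite cat_rcons Ew E; split.
Qed.

Definition tree_word (t : tree n) : seq 'I_n := raw_word t.

Lemma tree_wordK : cancel tree_word tr.
Proof. by move=> t; apply/val_inj/raw_wordK/(valP t). Qed.

Fixpoint mirror t : raw_tree n :=
  if t is Node t0 a0 a1 t1 then Node (mirror t1) a1 a0 (mirror t0) else Leaf.

Lemma raw_tr_rev w : raw_tr (rev w) = mirror (raw_tr w).
Proof.
have [k] := ubnP #|letters w|; elim: k w => // k IH w lek.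
have [-> | /[dup] /lsplit_ex [p [a [x spl]]] /rsplit_ex [y [b [q spr]]]] :=
  eqVneq w [::]; first by rewrite raw_tr_nil.
have cw := lsplit_card spl; have cw' := lsplit_card spr.
rewrite !letters_rev in cw'.
have Ep : raw_tr (rev p) = mirror (raw_tr p) by apply: IH; rewrite -ltnS -cw.
have Eq : raw_tr (rev q) = mirror (raw_tr q) by apply: IH; rewrite -ltnS -cw'.
rewrite (raw_tr_split spl spr) /= -Ep -Eq.
have spr' : rsplit (rev w) (rev x) a (rev p) by rewrite /rsplit !revK.
exact: raw_tr_split spr spr'.
Qed.

Lemma eq_raw_tr_letters u v : raw_tr u = raw_tr v -> letters u = letters v.
Proof. by move=> E; rewrite -(raw_trP u).2 -(raw_trP v).2 E. Qed.

Lemma eq_raw_tr_rev u v : raw_tr u = raw_tr v -> raw_tr (rev u) = raw_tr (rev v).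
Proof. by rewrite !raw_tr_rev => ->. Qed.

Lemma eq_raw_tr_lsplit u v p a x : raw_tr u = raw_tr v -> lsplit u p a x ->
  exists q y, lsplit v q a y /\ raw_tr p = raw_tr q.
Proof.
move=> E spu; have Ec := eq_raw_tr_letters E.
have u0 : u != [::] by case: spu => -> _ _; case: (p).
have v0 : v != [::].
  apply: contraTneq isT => v0; have := lsplit_card spu.
  by rewrite Ec v0 letters_nil cards0.
have [q [c [y spv]]] := lsplit_ex v0.
have [x' [b [p' spu']]] := rsplit_ex u0.
have [y' [d [q' spv']]] := rsplit_ex v0.
move: E; rewrite (raw_tr_split spu spu') (raw_tr_split spv spv') => -[Ep Eac _ _].
by exists q, y; rewrite Eac.
Qed.

(* The first letter outside [A], in two words with the same tree. *)
Lemma eq_raw_tr_outside (A : {set 'I_n}) u v :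
  raw_tr u = raw_tr v -> ~~ (letters u \subset A) ->
  exists p a x q y, [/\ u = p ++ a :: x, v = q ++ a :: y,
    raw_tr p = raw_tr q, a \notin A :|: letters p
    & letters u \subset a |: (A :|: letters p)].
Proof.
have [k] := ubnP #|letters u|; elim: k u v => // k IH u v lek Euv uA.
have u0 : u != [::] by apply: contraNneq uA => ->; rewrite letters_nil sub0set.
have [p [a [x spu]]] := lsplit_ex u0.
have [q [y [spv Epq]]] := eq_raw_tr_lsplit Euv spu.
have [Eu ap Lu] := spu; have [Ev _ _] := spv.
have [aA|aA] := boolP (a \in A); last first.
  exists p, a, x, q, y; split=> //; first by rewrite in_setU negb_or aA.
  by rewrite Lu setUS // subsetUr.
have ltk : #|letters p| < k by rewrite -ltnS -(lsplit_card spu).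
have [|p1 [b [x1 [q1 [y1 [Ep Eq E1 bN sub]]]]]] := IH p q ltk Epq.
  by apply: contra uA => pA; rewrite Lu subUset sub1set aA.
exists p1, b, (x1 ++ a :: x), q1, (y1 ++ a :: y); split=> //.
- by rewrite Eu Ep -catA.
- by rewrite Ev Eq -catA.
by rewrite Lu subUset sub sub1set !in_setU aA orbT.
Qed.

Lemma lsplit_cat_l u v p a x :
  letters v \subset letters u -> lsplit u p a x -> lsplit (u ++ v) p a (x ++ v).
Proof.
move=> vu [E ap Eu]; split=> //; first by rewrite E -catA.
by rewrite letters_cat (setUidPl vu).
Qed.

Lemma eq_raw_tr_cat u u' v v' : raw_tr u = raw_tr u' -> raw_tr v = raw_tr v' ->
  raw_tr (u ++ v) = raw_tr (u' ++ v').
Proof.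
have [k] := ubnP #|letters (u ++ v)|.
elim: k u u' v v' => // k IH u u' v v' lek Eu Ev.
have Lu := eq_raw_tr_letters Eu; have Lv := eq_raw_tr_letters Ev.
have half (r r' s s' : seq 'I_n) : #|letters (r ++ s)| <= k -> r ++ s != [::] ->
    raw_tr r = raw_tr r' -> raw_tr s = raw_tr s' ->
  exists p a x p' x', [/\ lsplit (r ++ s) p a x, lsplit (r' ++ s') p' a x'
                        & raw_tr p = raw_tr p'].
  move=> lerk rs0 Er Es.
  have Lr := eq_raw_tr_letters Er; have Ls := eq_raw_tr_letters Es.
  have [sr|sr] := boolP (letters s \subset letters r).
    have r0 : r != [::].
      apply: contraNneq rs0 => r0; move: sr; rewrite r0 letters_nil subset0.
      by case: (s) => // c s1 /eqP/setP/(_ c); rewrite !inE eqxx.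
    have [p [a [x spr]]] := lsplit_ex r0.
    have [p' [x' [spr' Ep]]] := eq_raw_tr_lsplit Er spr.
    exists p, a, (x ++ s), p', (x' ++ s'); split=> //; apply: lsplit_cat_l => //.
    by rewrite -Ls -Lr.
  have [p [a [x [p' [x' [Es1 Es1' Ep aN sub]]]]]] := eq_raw_tr_outside Es sr.
  have L : letters (r ++ s) = a |: letters (r ++ p).
    apply/eqP; rewrite eqEsubset !letters_cat; apply/andP; split.
      by rewrite subUset sub andbT setUCA subsetUl.
    rewrite Es1 letters_cat letters_cons.
    by apply/subsetP=> i; rewrite !in_setU; do !case: (i \in _).
  have sprs : lsplit (r ++ s) (r ++ p) a x.
    by split=> //; rewrite ?letters_cat // Es1 catA.
  have Erp : raw_tr (r ++ p) = raw_tr (r' ++ p').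
    by apply: IH => //; rewrite -(lsplit_card sprs).
  exists (r ++ p), a, x, (r' ++ p'), x'; split=> //; split.
  - by rewrite Es1' catA.
  - by rewrite -(eq_raw_tr_letters Erp) letters_cat.
  - by rewrite -(eq_raw_tr_letters Erp) -L !letters_cat Lr Ls.
have [E0|w0] := eqVneq (u ++ v) [::].
  have : letters (u' ++ v') = set0.
    by rewrite letters_cat -Lu -Lv -letters_cat E0 letters_nil.
  rewrite E0; case: (u' ++ v') => // c w /setP/(_ c).
  by rewrite !inE eqxx.
have [p [a [x [p' [x' [spl spl' Ep]]]]]] := half u u' v v' lek w0 Eu Ev.
have [] := half (rev v) (rev v') (rev u) (rev u');
  rewrite -?rev_cat ?letters_rev //.
- by rewrite -size_eq0 size_rev size_eq0.
- exact: eq_raw_tr_rev.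
- exact: eq_raw_tr_rev.
move=> q [b [y [q' [y' [spr spr' Eq]]]]].
have rspl z r c y1 : lsplit (rev z) r c y1 -> rsplit z (rev y1) c (rev r).
  by rewrite /rsplit !revK.
rewrite (raw_tr_split spl (rspl _ _ _ _ spr)).
by rewrite (raw_tr_split spl' (rspl _ _ _ _ spr')) Ep (eq_raw_tr_rev Eq).
Qed.

(* By [tr_cat], [tr_nil] and the surjectivity of [tr] (lemma [tree_wordK]), this
   is the only monoid structure on trees for which [tr] is a morphism. *)
Definition tree_mul (s t : tree n) : tree n := tr (tree_word s ++ tree_word t).
Definition tree_one : tree n := @Tree n Leaf isT.

Lemma tr_cat u v : tr (u ++ v) = tree_mul (tr u) (tr v).
Proof.
by apply/val_inj/eq_raw_tr_cat; apply/esym/raw_wordK/(valP (tr _)).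
Qed.

Lemma tr_nil : tr [::] = tree_one.
Proof. exact/val_inj/raw_tr_nil. Qed.

Fact tree_mulA : associative tree_mul.
Proof.
move=> s t u; rewrite -[s]tree_wordK -[t]tree_wordK -[u]tree_wordK.
by rewrite -!tr_cat catA.
Qed.

Fact tree_mul1l : left_id tree_one tree_mul.
Proof. by move=> t; rewrite -[t]tree_wordK -tr_nil -tr_cat. Qed.

Fact tree_mul1r : right_id tree_one tree_mul.
Proof. by move=> t; rewrite -[t]tree_wordK -tr_nil -tr_cat cats0. Qed.

HB.instance Definition _ :=
  isMonoid.Build (tree n) tree_mulA tree_mul1l tree_mul1r.

End Tr.

Import classical_sets functions.
Local Open Scope classical_set_scope.

Section ComplementaryTriples.
Local Open Scope group_scope.
Variable n : nat.
Implicit Types (S D U : set (tree n)) (p : {ffun {set 'I_n} -> bool}).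

Definition subsemigroup U : Prop := forall s t, U s -> U t -> U (s * t).

(* x \ U / y *)
Definition two_sided_residual (x : tree n) U (y : tree n) : set (tree n) :=
  [set t | U (x * t * y)].

Definition replete S : Prop :=
  subsemigroup S /\ forall x y, subsemigroup (two_sided_residual x S y).

Definition alpha_bar U : set {set 'I_n} := [set alpha t | t in U].

Definition sparse D : Prop :=
  forall s t, D s -> D t -> alpha s \subset alpha t -> s = t.

Definition dominates S D : Prop :=
  [/\ alpha_bar D `&` alpha_bar S = set0,
      subsemigroup (D `|` S)
    & forall t A, D t -> alpha_bar (D `|` S) A -> A \subset alpha t ->
        A = alpha t].

Definition parity_function S D p : Prop :=
  (forall A, alpha_bar D A -> p A = true) /\
  (forall A, p A = true -> alpha_bar (S `|` D) A).

Definition complementary_triples :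
    set (set (tree n) * set (tree n) * {ffun {set 'I_n} -> bool}) :=
  [set T | let: (U, D, p) := T in
     [/\ replete U, sparse D, dominates U D & parity_function U D p]].

End ComplementaryTriples.

Arguments complementary_triples : clear implicits.

(* Main.v *)
Require Import Defs.
From mathcomp Require Import boolp classical_sets functions.
From mathcomp Require Import all_boot ssralg generic_quotient.

Set Implicit Arguments.
Unset Strict Implicit.
Unset Printing Implicit Defensive.

Import GRing.Theory.
Local Open Scope classical_set_scope.

(** An element of the free mirig is a finite sum of trees, with repetitions, and
    x + y = (x + y)^2 = x + y + xy + yx shows what a sum hides. If s and t are
    two distinct terms of r (possibly two copies of the same tree), then r absorbs 2st, that is r + 2st = r; and the
    trees absorbed in this way form a replete set, because
    xsy + xty = x(s + t)y also produces xsty. Let S(r) be the least replete set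
    that contains the products of any two distinct terms of r. If a term t has
    another term s with a smaller or equal alphabet, then t = tst = (ts)(st)
    belongs to S(r); the remaining terms form the set D(r): each t in D(r) is
    the only term, with multiplicity one, whose alphabet is contained in that of
    t. Let finally p(r) send an alphabet A to the parity of the number of terms
    of alphabet A. The bijection is r |-> (S(r), D(r), p(r)), and four facts
    make it one.

    - The triple does not depend on the chosen sum. What is compared is the
      relation [indist] between lists of trees: the same replete sets contain
      all products of distinct terms, each alphabet has the same answer to
      whether no, one (and which), or several terms lie below it, and the
      numbers of terms have the same parities. It is a congruence for sum
      ([indist_cat]) and product ([indist_mul]) and identifies a sum with its
      square ([indist_square]), hence descends to the free mirig
      ([eq_treesum_indist]). The product case rests on [orth_mulm]: a replete
      set that contains (xsy)(xty) and (xty)(xsy) contains xsty.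

    - Two sums with the same triple are equal ([triple_of_inj]). Both absorb 2t
      for t in S, and a sum r with this property satisfies r + a = r + b for
      a and b in S with the same alphabet ([absorbs_swap]). So outside D only
      parities count.

    - The triple of a sum is complementary ([triple_of_complementary]).

    - Every complementary triple is the triple of the sum of D, twice S, and
      one tree of S of alphabet A for each A outside the alphabets of D with
      p(A) = 1 ([triple_of_surj]); this sum is finite because there are
      finitely many trees.

    That sums of trees have a value in the free mirig at all is the solution of
    the word problem for free bands: words with the same tree are equal in
    every band ([eq_tr_wordval]). *)

(** * Trees and replete sets *)

Section Trees.
Local Open Scope group_scope.
Variable n : nat.
Implicit Types (s t w z : tree n) (R : set (tree n)).

Lemma alphaM s t : alpha (s * t) = alpha s :|: alpha t.
Proof.
by rewrite -[s in RHS]tree_wordK -[t in RHS]tree_wordK !alpha_tr -letters_cat -alpha_tr.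
Qed.

(** The first and the last occurrences of letters, hence the tree, are read off
    the two outer copies of [u]. *)
Lemma tr_sandwich (u v : seq 'I_n) :
  letters v \subset letters u -> tr (u ++ v ++ u) = tr u.
Proof.
move=> vu; have [u0|u0] := eqVneq u [::].
  move: vu; rewrite u0 letters_nil subset0; case: v => // c v.
  by move/eqP/setP/(_ c); rewrite !inE eqxx.
have [p [a [x spl]]] := lsplit_ex u0.
have [y [b [q spr]]] := rsplit_ex u0.
apply: val_inj => /=; rewrite (raw_tr_split spl spr).
have vuu : letters (v ++ u) \subset letters u.
  by rewrite letters_cat subUset vu subxx.
apply: (raw_tr_split (lsplit_cat_l vuu spl)).
  rewrite /rsplit catA rev_cat.
have := @lsplit_cat_l n (rev u) (rev (u ++ v)) _ _ _ _ spr.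
rewrite !letters_rev letters_cat subUset vu subxx => /(_ isT).
rewrite -[X in lsplit _ _ _ X]revK; exact.
Qed.

Lemma treeMKM w z : alpha z \subset alpha w -> w * z * w = w.
Proof.
rewrite -[w]tree_wordK -[z]tree_wordK !alpha_tr => /tr_sandwich {3}<-.
by rewrite !tr_cat; apply/esym/mulgA.
Qed.

Lemma treexx w : w * w = w.
Proof.
have := @treeMKM w 1; rewrite mulg1; apply.
have := alphaM w 1; rewrite mulg1 => ->; exact: subsetUr.
Qed.

Lemma repleteP R : replete R <->
  forall x y s t, R (x * s * y) -> R (x * t * y) -> R (x * (s * t) * y).
Proof.
split=> [[_ H] x y s t Rs Rt|H]; first exact: H.
split=> [s t Rs Rt|x y s t]; last exact: H.
by have := H 1 1 s t; rewrite !mul1g !mulg1; apply.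
Qed.

Lemma repleteM R s t : replete R -> R s -> R t -> R (s * t).
Proof. by case=> H _; apply: H. Qed.

Lemma replete_residual R x y : replete R -> replete (two_sided_residual x R y).
Proof.
move=> /repleteP H; apply/repleteP => x' y' s t.
rewrite /two_sided_residual /= => Rs Rt.
have := H (x * x') (y' * y) s t; rewrite -!mulgA in Rs Rt *.
by apply.
Qed.

Lemma repleteI R R' : replete R -> replete R' -> replete (R `&` R').
Proof.
move=> /repleteP H /repleteP H'; apply/repleteP => x y s t [? ?] [? ?].
by split; [apply: H | apply: H'].
Qed.

(** A sum in which [s] and [t] are two distinct terms absorbs twice [s * t] and
    twice [t * s]: this is the constraint that the pair puts on the set of
    absorbed trees. *)
Definition orth R s t := `[< R (s * t) /\ R (t * s) >].

Lemma orthP R s t : reflect (R (s * t) /\ R (t * s)) (orth R s t).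
Proof. exact: asboolP. Qed.

Lemma orth_sym R : symmetric (orth R).
Proof. by move=> s t; apply/orthP/orthP => -[]. Qed.

Lemma orth_mem R s t : replete R -> R s -> R t -> orth R s t.
Proof. by move=> Rr Rs Rt; apply/orthP; split; apply: repleteM. Qed.

Lemma replete_orth R d x y : replete R -> replete [set s | orth R d (x * s * y)].
Proof.
move=> Rr.
have -> : [set s | orth R d (x * s * y)] =
    two_sided_residual (d * x) R y `&` two_sided_residual x R (y * d).
  apply/seteqP; split=> s /=; rewrite /two_sided_residual /=.
    by move/orthP; rewrite !mulgA.
  by rewrite -!mulgA => H; apply/orthP; rewrite -!mulgA.
by apply: repleteI; apply: replete_residual.
Qed.

Lemma replete_orth1 R d : replete R -> replete [set s | orth R d s].
Proof.
move=> /(replete_orth d 1 1); congr replete.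
by apply/seteqP; split=> s /=; rewrite mul1g mulg1.
Qed.

(** With [d = x * s * y] and [e = x * t * y], the residual of [R] by [x] and
    [y * (e * d * e)] contains [s] and [t], because [d * (e * d * e) = d * e] and
    [e * (e * d * e) = e * (d * e)]; so does the residual by [d * e * d * x] and
    [y]. Hence [R] contains both
    [w * (e * d * e)] and [(d * e * d) * w] for [w = x * (s * t) * y], and their
    product is [w], everything between the two copies of [w] having no new
    letter. *)
Lemma orth_mulm R x y s t : replete R ->
  orth R (x * s * y) (x * t * y) -> R (x * (s * t) * y).
Proof.
move=> Rr /orthP []; set d := x * s * y; set e := x * t * y => Rde Red.
have Rded : R (d * e * d).
  have <- : d * e * (e * d) = d * e * d by rewrite mulgA -(mulgA d) treexx.
  exact: repleteM.
have Rede : R (e * d * e).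
  have <- : e * d * (d * e) = e * d * e by rewrite mulgA -(mulgA e) treexx.
  exact: repleteM.
have /repleteP Rc := Rr; set w := x * (s * t) * y.
have R1 : R (w * (e * d * e)).
  have -> : w * (e * d * e) = x * (s * t) * (y * (e * d * e)).
    by rewrite /w !mulgA.
  apply: Rc.
    have -> : x * s * (y * (e * d * e)) = d * e * (d * e) by rewrite !mulgA.
    by rewrite treexx.
  have -> : x * t * (y * (e * d * e)) = e * e * (d * e) by rewrite !mulgA.
  by rewrite treexx mulgA.
have R2 : R (d * e * d * w).
  have -> : d * e * d * w = (d * e * d * x) * (s * t) * y by rewrite /w !mulgA.
  apply: Rc.
    have -> : d * e * d * x * s * y = d * e * (d * d) by rewrite !mulgA.
    by rewrite treexx.
  have -> : d * e * d * x * t * y = d * e * (d * e) by rewrite !mulgA.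
  by rewrite treexx.
have <- : w * (e * d * e * (d * e * d)) * w = w.
  apply: treeMKM; rewrite /w /e /d !alphaM; apply/subsetP => i; rewrite !in_setU.
  by do !case: (i \in _).
have -> : w * (e * d * e * (d * e * d)) * w = w * (e * d * e) * (d * e * d * w).
  by rewrite !mulgA.
exact: repleteM.
Qed.
End Trees.

(** * Sums of trees and what they determine *)

(** Two distinct positions of a list hold two distinct values, or the same
    value that then occurs twice. *)
Lemma pairwise_symP (T : eqType) (r : rel T) (l : seq T) : symmetric r ->
  reflect (forall s t, s \in l -> t \in l -> (s = t -> 1 < count_mem s l) ->
             r s t)
          (pairwise r l).
Proof.
move=> rC; elim: l => [|a l IH] /=; first by constructor.
apply: (iffP andP) => [[/allP ral /IH H] s t|H].
  rewrite !in_cons => /predU1P [->|sl] /predU1P [->|tl].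
  - by rewrite eqxx ltnS -has_count has_pred1 => /(_ erefl); apply: ral.
  - by move=> _; apply: ral.
  - by rewrite rC => _; apply: ral.
  - case: (eqVneq a s) => [<- _|_ st]; last exact: H.
    exact: ral.
split; last first.
  apply/IH => s t sl tl st; apply: H; rewrite ?in_cons ?sl ?tl ?orbT //.
  by move/st/leq_trans; apply; apply: leq_addl.
apply/allP => t tl; apply: H; rewrite ?in_cons ?eqxx ?tl ?orbT //.
by move=> ->; rewrite /= ?eqxx ltnS -has_count has_pred1.
Qed.

Section Invariants.
Local Open Scope group_scope.
Variable n : nat.
Implicit Types (s t w z : tree n) (R : set (tree n)) (l : seq (tree n)).
Implicit Types (B : {set 'I_n}).

Definition below B l := [seq t <- l | alpha t \subset B].

(** The value of the sum in the mirig made of a zero, the trees, and one further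
    element, here [None], to which all sums of two or more trees are equal. *)
Definition sole l : option (option (tree n)) :=
  match l with [::] => Some None | [:: t] => Some (Some t) | _ => None end.

Lemma sole_cat l1 l2 l1' l2' : sole l1 = sole l1' -> sole l2 = sole l2' ->
  sole (l1 ++ l2) = sole (l1' ++ l2').
Proof.
by case: l1 l1' l2 l2' => [|a [|b l1]] [|a' [|b' l1']] [|c [|d l2]] [|c' [|d' l2']].
Qed.

Lemma sole_map (f : tree n -> tree n) l l' : sole l = sole l' ->
  sole (map f l) = sole (map f l').
Proof. by case: l l' => [|a [|b l]] [|a' [|b' l']] //= [->]. Qed.

Lemma sole_single l t : sole l = Some (Some t) <-> l = [:: t].
Proof. by split=> [|->//]; case: l => [|a [|b l]] // [->]. Qed.

(** Parities are taken over all families [P] of alphabets, and not only over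
    single alphabets, so that multiplying by a tree on either side merely changes
    [P]. *)
Definition indist l l' :=
  [/\ forall R, replete R -> pairwise (orth R) l = pairwise (orth R) l',
      forall B, sole (below B l) = sole (below B l')
    & forall P : pred {set 'I_n},
        odd (count (P \o @alpha n) l) = odd (count (P \o @alpha n) l')].

Lemma indist_sym l l' : indist l l' -> indist l' l.
Proof. by case=> H1 H2 H3; split=> // R Rr; rewrite H1. Qed.

Lemma indist_trans l1 l2 l3 : indist l1 l2 -> indist l2 l3 -> indist l1 l3.
Proof.
case=> H1 H2 H3 [K1 K2 K3]; split=> [R Rr|B|P].
- by rewrite H1 // K1.
- by rewrite H2 K2.
- by rewrite H3 K3.
Qed.

Lemma perm_indist l l' : perm_eq l l' -> indist l l'.
Proof.
move=> El; split=> [R Rr|B|P]; last by rewrite (permP El).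
  apply/pairwise_symP/pairwise_symP; try exact: orth_sym.
    by move=> H s t; rewrite -!(perm_mem El) -(permP El); apply: H.
  by move=> H s t; rewrite !(perm_mem El) (permP El); apply: H.
have := perm_filter (fun t => alpha t \subset B) El; rewrite -/(below B l) -/(below B l').
case: (below B l) => [|a [|b k]] E.
- by move: E; rewrite perm_sym => /perm_small_eq ->.
- by move: E; rewrite perm_sym => /perm_small_eq ->.
- by have := perm_size E; case: below => [|c [|d k']].
Qed.

(** A term either is alone below its alphabet, or is paired with another term
    of smaller or equal alphabet. *)
Lemma single_below t l : t \in l -> below (alpha t) l = [:: t] \/
  exists2 s, s \in l & alpha s \subset alpha t /\ (s = t -> 1 < count_mem t l).
Proof.
move=> tl; have [c1|] := ltnP 1 (count_mem t l); first by right; exists t.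
rewrite leq_eqVlt ltnS leqn0 => /orP [/eqP c1|]; last first.
  by move/eqP/count_memPn; rewrite tl.
have [/hasP [s sl /andP [st sub]]|noS] :=
  boolP (has (fun s => (s != t) && (alpha s \subset alpha t)) l).
  by right; exists s => //; split=> // Es; rewrite Es eqxx in st.
left; have -> : below (alpha t) l = filter (pred1 t) l.
  apply: eq_in_filter => s sl /=; have := hasPn noS s sl.
  by case: eqVneq => [-> _|_ /negPf //]; rewrite subxx.
by have /all_pred1P -> := filter_all (pred1 t) l; rewrite size_filter c1.
Qed.

(** Because [t = (t * s) * (s * t)]. *)
Lemma orth_doubled R s t : replete R -> orth R s t -> alpha s \subset alpha t -> R t.
Proof.
move=> Rr /orthP [Rst Rts] st; have <- : t * s * (s * t) = t.
  by rewrite mulgA -(mulgA t) treexx treeMKM.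
exact: repleteM.
Qed.

Lemma below_single_mem B l t : below B l = [:: t] -> t \in l.
Proof.
move=> E; have: t \in below B l by rewrite E inE.
by rewrite mem_filter => /andP [].
Qed.

(** A term of [l'] that is alone below its alphabet is shared with [l]; any
    other one is a product of two products of distinct terms, and the replete
    sets that contain all those are the same for [l] and [l']. *)
Lemma indist_replete R l l' : indist l l' -> replete R ->
  {in l, forall s, R s} -> {in l', forall s, R s}.
Proof.
move=> [H1 H2 _] Rr Rl t tl'.
have/pairwise_symP Hl' : pairwise (orth R) l'.
  rewrite -H1 //; apply/pairwise_symP; first exact: orth_sym.
  by move=> s u sl ul _; apply: orth_mem => //; apply: Rl.
have [E|[s sl' [st ct]]] := single_below tl'.
  apply: Rl; have /sole_single : sole (below (alpha t) l) = Some (Some t).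
    by rewrite H2 E.
  exact: below_single_mem.
apply: (@orth_doubled R s t) => //; apply: Hl' => //; first exact: orth_sym.
by move=> Est; rewrite Est; apply: ct.
Qed.

Lemma below_cat B l1 l2 : below B (l1 ++ l2) = below B l1 ++ below B l2.
Proof. exact: filter_cat. Qed.

Lemma indist_cat l1 l1' l2 l2' : indist l1 l1' -> indist l2 l2' ->
  indist (l1 ++ l2) (l1' ++ l2').
Proof.
have half k1 k1' k2 k2' R : replete R -> indist k1 k1' -> indist k2 k2' ->
    pairwise (orth R) (k1 ++ k2) -> pairwise (orth R) (k1' ++ k2').
  move=> Rr E1 E2; rewrite !pairwise_cat => /and3P [/allrelP A].
  have [-> // _ _] := E1; have [-> // _ _] := E2; move=> -> ->; rewrite !andbT.
  apply/allrelP => s t sk tk.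
  have Rd d : replete [set s | orth R d s] by exact: replete_orth1.
  rewrite orth_sym; apply: (indist_replete E1 (Rd t)) sk => s' sk' /=.
  rewrite orth_sym; apply: (indist_replete E2 (Rd s')) tk => t' tk' /=.
  exact: A.
move=> E1 E2; split=> [R Rr|B|P].
- apply/idP/idP; apply: half => //; exact: indist_sym.
- by rewrite !below_cat; apply: sole_cat; [case: E1 | case: E2].
- by rewrite !count_cat !oddD; case: E1 => _ _ ->; case: E2 => _ _ ->.
Qed.

Lemma orth_mul R d e f : replete R -> orth R e f -> d = e \/ orth R d e ->
  d = f \/ orth R d f -> orth R (d * e) (d * f) /\ orth R (e * d) (f * d).
Proof.
move=> Rr ef; have /orthP [Ref Rfe] := ef.
have sandwich a b : R (a * b) -> R (b * a) -> R (a * (b * a)).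
  have <- : a * b * (b * a) = a * (b * a) by rewrite !mulgA -(mulgA a b b) treexx.
  exact: repleteM.
have [Refe Rfef] := (sandwich _ _ Ref Rfe, sandwich _ _ Rfe Ref).
have mulKl (a b : tree n) : a * (a * b) = a * b by rewrite mulgA treexx.
case=> [->|/orthP [Rde Red]].
  by move=> _; split; apply/orthP; split; rewrite ?treexx -?mulgA ?treexx ?mulKl.
case=> [->|/orthP [Rdf Rfd]].
  by split; apply/orthP; split; rewrite ?treexx -?mulgA ?treexx ?mulKl.
by split; apply: orth_mem.
Qed.

(** The products of two distinct terms of a sum [l] are orthogonal to every term
    of [l], inside a context [x * _ * y]; the two disjunctions cover the case
    where [d] comes from [s] or [t] itself. *)
Lemma orth_mulc R x y d s t : replete R ->
    orth R (x * s * y) (x * t * y) ->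
    d = x * s * y \/ orth R d (x * s * y) ->
    d = x * t * y \/ orth R d (x * t * y) ->
  orth R d (x * (s * t) * y).
Proof.
move=> Rr st ds dt; have [dl dr] := orth_mul Rr st ds dt.
apply/orthP; split.
  have := @orth_mulm n R (d * x) y s t Rr; rewrite !mulgA in dl *; exact.
have := @orth_mulm n R x (y * d) s t Rr; rewrite !mulgA in dr *; exact.
Qed.

(** The orthogonality of [x * s * y] and [x * t * y] for [s] and [t] in [l'] is
    obtained by replacing terms of [l'] by terms of [l] one at a time: for fixed
    [d], the trees [s] such that [d] is orthogonal to [x * s * y] form a replete
    set. This set contains all products of distinct terms of [l] when
    [d = x * s1 * y] with [s1] in [l]; so it contains every term of [l'] that is
    not alone below its alphabet. *)
Lemma indist_map x y l l' : indist l l' ->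
  indist [seq x * s * y | s <- l] [seq x * s * y | s <- l'].
Proof.
pose c s := x * s * y; rewrite -!/(map c _).
have half k k' R : replete R -> indist k k' ->
    pairwise (orth R) (map c k) -> pairwise (orth R) (map c k').
  move=> Rr E; have [H1 H2 _] := E; move/pairwise_symP => G.
  have {}G s t : s \in k -> t \in k -> (s = t -> 1 < count_mem s k) ->
      orth R (c s) (c t).
    move=> sk tk st; apply: G; [exact: orth_sym | exact: map_f | exact: map_f |].
    case: (eqVneq s t) => [Est _|st' Ec].
      apply: leq_trans (st Est) _; rewrite count_map; apply: sub_count => u /= /eqP ->.
      exact: eqxx.
    rewrite count_map.
    have: 1 < count (predU (pred1 s) (pred1 t)) k.
      rewrite -(leq_add2r (count (predI (pred1 s) (pred1 t)) k)) count_predUI.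
      rewrite (@eq_count _ (predI _ _) pred0) ?count_pred0 ?addn0.
        by apply: (@leq_add 1 1); rewrite -has_count has_pred1.
      move=> u /=; apply/andP => -[/eqP -> /eqP Est]; by rewrite Est eqxx in st'.
    move/leq_trans; apply; apply: sub_count => u /= /orP [] /eqP ->; 
      rewrite /= ?Ec; exact: eqxx.
  (* For s1 in k the products of distinct terms of k, hence of k', can replace
     one side. *)
  have Gk s1 : s1 \in k -> pairwise (orth [set s | orth R (c s1) (c s)]) k.
    move=> s1k; apply/pairwise_symP => [|s t sk tk st]; first exact: orth_sym.
    have Hst := G _ _ sk tk st.
    have Hs : c s1 = c s \/ orth R (c s1) (c s).
      by case: (eqVneq s1 s) => [->|d1]; 
        [left | right; apply: G => // E1; rewrite E1 eqxx in d1].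
    have Ht : c s1 = c t \/ orth R (c s1) (c t).
      by case: (eqVneq s1 t) => [->|d1]; 
        [left | right; apply: G => // E1; rewrite E1 eqxx in d1].
    by apply/orthP; split; apply: orth_mulc; rewrite // orth_sym.
  (* Both sides now range over k', one of them not alone below its alphabet. *)
  have Gk' t : t \in k' -> below (alpha t) k' != [:: t] ->
      {in k', forall s, orth R (c s) (c t)}.
    move=> tk' /eqP nt s sk'; have [//|[u uk' [ut cu]]] := single_below tk'.
    rewrite orth_sym; apply: (indist_replete E (replete_orth (c t) x y Rr)) sk'.
    move=> s1 s1k; rewrite /= orth_sym; have R1 := replete_orth (c s1) x y Rr.
    apply: (@orth_doubled [set s | orth R (c s1) (c s)] u t) => //.
    have := Gk s1 s1k; rewrite H1 // => /pairwise_symP; apply=> //.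
      exact: orth_sym.
    by move=> Eut; rewrite Eut; apply: cu.
  have in_k t : below (alpha t) k' = [:: t] -> t \in k.
    move=> Et; have /sole_single Ebl : sole (below (alpha t) k) = Some (Some t).
      by rewrite H2 Et.
    exact: below_single_mem Ebl.
  have main s t : s \in k' -> t \in k' -> (s = t -> 1 < count_mem t k') ->
      orth R (c s) (c t).
    move=> sk tk st; have [Et|nt] := eqVneq (below (alpha t) k') [:: t]; last exact: Gk'.
    have [Es|ns] := eqVneq (below (alpha s) k') [:: s]; last by rewrite orth_sym Gk'.
    apply: G; [exact: in_k | exact: in_k |] => Est.
    have := st Est; rewrite ltnNge => /negP [].
    have: size (below (alpha t) k') = 1%N by rewrite Et.
    by rewrite size_filter => <-; apply: sub_count => u /= /eqP ->.
  apply/pairwise_symP; first exact: orth_sym.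
  move=> _ _ /mapP [s sk ->] /mapP [t tk ->] Ec.
  have [Est|st] := eqVneq s t; last by apply: main => // Est; rewrite Est eqxx in st.
  (* The value c s is repeated: either s itself is, or another term u of k' has
     c u = c s. *)
  subst t; have [cs|cs] := ltnP 1 (count_mem s k'); first exact: main.
  have [/hasP [u uk /andP [us /eqP cus]]|no] :=
      boolP (has (fun u => (u != s) && (c u == c s)) k').
    rewrite -{2}cus; apply: main => // Eus; by rewrite Eus eqxx in us.
  move: (Ec erefl); rewrite count_map ltnNge => /negP []; apply: leq_trans cs.
  rewrite -[X in _ <= X](@eq_in_count _ (preim c (pred1 (c s)))) // => u uk /=.
  by have := hasPn no u uk; case: eqVneq => [->|_ /negPf //]; rewrite eqxx.
move=> E; split=> [R Rr|B|P].
- by apply/idP/idP; apply: half => //; apply: indist_sym.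
- have bE k : below B (map c k) =
      if (alpha x \subset B) && (alpha y \subset B) then map c (below B k) else [::].
    rewrite /below filter_map; case: ifP => xyB; last first.
      rewrite (@eq_filter _ _ pred0) ?filter_pred0 // => s /=.
      by rewrite !alphaM !subUset; move: xyB; do !case: (_ \subset _).
    congr map; apply: eq_filter => s /=; rewrite !alphaM !subUset.
    by case/andP: xyB => -> ->; rewrite andbT.
  rewrite !bE; case: ifP => // _; apply: sole_map; by case: E.
- rewrite !count_map; case: E => _ _ /(_ (fun A => P (alpha x :|: A :|: alpha y))).
  by congr (_ = _); congr odd; apply: eq_count => s /=; rewrite !alphaM.
Qed.
End Invariants.

(** * Products of sums *)

Section Multiplication.
Local Open Scope group_scope.
Variable n : nat.
Implicit Types (s t w z a : tree n) (R : set (tree n)) (l : seq (tree n)).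
Implicit Types (B : {set 'I_n}).

(** The new terms [a * t] and [t * a] are in [R], which settles the products
    among them. In [a * t * u] and [u * t * a], the trees [t] and [u] may be the
    same term of [l]; but both belong to the replete set of the trees orthogonal
    to [a]. *)
Lemma orth_square R a l : replete R -> pairwise (orth R) (a :: l) ->
  pairwise (orth R) (a :: [seq a * t | t <- l] ++ [seq t * a | t <- l] ++ l).
Proof.
move=> Rr /= /andP [/allP al gl].
have alP t : t \in l -> R (a * t) /\ R (t * a) by move/al/orthP.
have Ra : replete [set t | orth R a t] by exact: replete_orth1.
rewrite catA pairwise_cat gl andbT.
set X := [seq a * t | t <- l] ++ [seq t * a | t <- l].
have XR : {in X, forall z, R z}.
  by move=> z; rewrite mem_cat => /orP [] /mapP [t /alP [? ?] ->].
have aX : {in X, forall z, orth R a z}.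
  move=> z; rewrite mem_cat => /orP [] /mapP [t /alP [at_ ta] ->]; apply/orthP.
    rewrite mulgA treexx; split=> //; rewrite -[a]treexx !mulgA -mulgA -(mulgA (a * a)).
    by rewrite treexx; have := repleteM Rr at_ ta; rewrite !mulgA -(mulgA a t t) treexx.
  rewrite -(mulgA t) treexx; split=> //.
  by have := repleteM Rr at_ ta; rewrite !mulgA -(mulgA a t t) treexx.
apply/and3P; split.
- by apply/allP => z; rewrite mem_cat => /orP [/aX|/al].
- apply/allrelP => z t zX tl; move: zX; rewrite mem_cat => /orP [] /mapP [u ul ->].
    have /orthP [H _] : orth R a (u * t) by apply: (repleteM Ra); apply: al.
    have [[au ua] [at_ ta]] := (alP _ ul, alP _ tl).
    apply/orthP; split; first by rewrite -mulgA.
    by have := repleteM Rr ta au; rewrite !mulgA -(mulgA t a a) treexx.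
  have /orthP [_ H] : orth R a (t * u) by apply: (repleteM Ra); apply: al.
  have [[au ua] [at_ ta]] := (alP _ ul, alP _ tl).
  apply/orthP; split; last by rewrite mulgA.
  by have := repleteM Rr ua at_; rewrite !mulgA -(mulgA u a a) treexx.
- apply/pairwise_symP; first exact: orth_sym.
  by move=> s t /XR Rs /XR Rt _; apply: orth_mem.
Qed.

(** The identity a + l = a + al + la + l is all that the square of a sum needs,
    by induction on its length. *)
Lemma indist_square_cons a l :
  indist (a :: l) (a :: [seq a * t | t <- l] ++ [seq t * a | t <- l] ++ l).
Proof.
split=> [R Rr|B|P].
- apply/idP/idP; first exact: orth_square.
  by rewrite /= !all_cat !pairwise_cat 
    => /andP [/and3P [_ _ ->] /and4P [_ _ _ /andP [_ ->]]].
- rewrite /below /= !filter_cat !filter_map.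
  have -> : [seq t <- l | preim (mul a) (fun t0 => alpha t0 \subset B) t] =
     if alpha a \subset B then below B l else [::].
    rewrite /below; case: ifP => aB.
      by apply: eq_filter => t /=; rewrite alphaM subUset aB.
    rewrite -[RHS](filter_pred0 l).
    by apply: eq_filter => t /=; rewrite alphaM subUset aB.
  have -> : [seq t <- l | preim (fun t => t * a) (fun t0 => alpha t0 \subset B) t] =
     if alpha a \subset B then below B l else [::].
    rewrite /below; case: ifP => aB.
      by apply: eq_filter => t /=; rewrite alphaM subUset aB andbT.
    rewrite -[RHS](filter_pred0 l).
    by apply: eq_filter => t /=; rewrite alphaM subUset aB andbF.
  by case: ifP => //; rewrite -/(below B l); case: (below B l).
- rewrite /= !count_cat !count_map.
  rewrite (@eq_count _ (preim (mul^~ a) _) (preim (mul a) (P \o @alpha n))).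
    by rewrite !oddD addKb.
  by move=> t /=; rewrite !alphaM setUC.
Qed.

Lemma indist_mul l1 l1' l2 l2' : indist l1 l1' -> indist l2 l2' ->
  indist [seq s * t | s <- l1, t <- l2] [seq s * t | s <- l1', t <- l2'].
Proof.
move=> E1 E2; apply: (@indist_trans _ _ [seq s * t | s <- l1', t <- l2]).
  elim: l2 {E2} => [|t l IH]; first by rewrite !allpairs0r.
  apply: indist_trans (perm_indist (permEl (perm_allpairs_consr _ _ _ _))) _.
  apply: indist_trans (indist_sym (perm_indist (permEl (perm_allpairs_consr _ _ _ _)))).
  apply: indist_cat IH; have := indist_map 1 t E1.
  by congr indist; apply: eq_map => s; rewrite mul1g.
elim: l1' {E1} => [|s l IH] //=.
apply: indist_cat IH; have := indist_map s 1 E2.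
by congr indist; apply: eq_map => t; rewrite mulg1.
Qed.

Lemma indist_square l : indist l [seq s * t | s <- l, t <- l].
Proof.
elim: l => [|a l IH] //=.
apply: indist_trans (indist_square_cons a l) _; rewrite treexx.
apply: (@indist_cat _ [:: a] [:: a]) => //; apply: indist_cat => //.
apply: indist_trans (indist_sym (perm_indist (permEl (perm_allpairs_consr _ _ _ _)))).
exact: indist_cat IH.
Qed.
End Multiplication.

(** * Rigs in which every element is idempotent *)

Section IdempotentRig.
Local Open Scope ring_scope.
Variables (M : pzSemiRingType) (idem : forall x : M, x * x = x).
Implicit Types (a b c r u v w x y z : M).

(** In a band, [x] is [a * y * x], by [(a * y) * (a * y) = a * y]. Therefore
    [x * y * x = a * (y * x) * (y * x) = x]. *)
Lemma band_factor a b x y : x = a * y * b -> x * y * x = x.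
Proof.
move=> E; have Ex : a * (y * x) = x by rewrite {1}E !mulrA -(mulrA (a * y)) idem -E.
by rewrite -{1}Ex -!mulrA (mulrA y) idem.
Qed.

(** [x] has the factor [z * x * y], whose square has the factor [y * z]. *)
Lemma band_factorM x y z : x * y * x = x -> x * z * x = x -> x * (y * z) * x = x.
Proof.
move=> Ey Ez; apply: (@band_factor (x * z * x) (x * y * x)).
have E : x * (z * x * y) * x = x by rewrite !mulrA Ez Ey.
by rewrite -{1}E -(idem (z * x * y)) !mulrA.
Qed.

Section Words.
Variables (n : nat) (g : 'I_n -> M).
Implicit Types (p q s t : seq 'I_n).

Definition wordval s : M := \prod_(i <- s) g i.

Lemma wordval_cat s t : wordval (s ++ t) = wordval s * wordval t.
Proof. exact: big_cat. Qed.

Lemma wordval_cons i t : wordval (i :: t) = g i * wordval t.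
Proof. exact: big_cons. Qed.

Lemma wordval_sandwich s t : letters t \subset letters s ->
  wordval s * wordval t * wordval s = wordval s.
Proof.
elim: t => [|i t IH]; first by rewrite /wordval big_nil mulr1 idem.
rewrite letters_cons subUset sub1set in_letters => /andP [si /IH Et].
rewrite wordval_cons; apply: band_factorM Et.
case/splitPr: si => s1 s2; rewrite wordval_cat wordval_cons.
exact/(@band_factor (wordval s1) (wordval s2))/mulrA.
Qed.

(** The value of [s] is that of [p a] times that of [b q], since both words have
    all the letters of [s] and whatever is inserted between them can be removed
    ([wordval_sandwich]). *)
Lemma wordval_split s p (a : 'I_n) (x y : seq 'I_n) (b : 'I_n) q :
  lsplit s p a x -> rsplit s y b q ->
  wordval s = wordval p * g a * (g b * wordval q).
Proof.
move=> [Es _ Ls] /rsplitP [Es' _ Ls'].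
set v := b :: q; set w := rcons p a.
have Lw : letters w = letters s.
  by rewrite Ls /w -cats1 letters_cat letters_cons letters_nil setU0 setUC.
have Lv : letters v = letters s by rewrite Ls' letters_cons.
have -> : wordval p * g a = wordval w.
  by rewrite /w -cats1 wordval_cat wordval_cons /wordval big_nil mulr1.
rewrite -wordval_cons -/v.
have sub t : letters t \subset letters s ->
    wordval w * wordval t * wordval v = wordval w * wordval v.
  move=> ts; rewrite -{1}(@wordval_sandwich v w) ?Lw ?Lv //.
  have := @wordval_sandwich w (t ++ v).
  rewrite letters_cat Lw Lv subUset ts subxx => /(_ isT).
  by rewrite wordval_cat !mulrA => ->.
have Ew : s = w ++ x by rewrite Es /w cat_rcons.
have xs : letters x \subset letters s by rewrite Ew letters_cat subsetUr.
have ys : letters y \subset letters s by rewrite Es' letters_cat subsetUl.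
rewrite -[LHS]idem {1}Ew {1}Es' !wordval_cat -/v -(sub (x ++ y)) ?wordval_cat ?mulrA //.
by rewrite letters_cat subUset xs ys.
Qed.

(** By induction on the number of letters, the value of a word is determined by
    the four components of its tree. *)
Lemma eq_tr_wordval s t : tr s = tr t -> wordval s = wordval t.
Proof.
move/(congr1 (@rtree n)) => /=.
have [k] := ubnP #|letters s|; elim: k s t => // k IH s t lek E.
have Lst := eq_raw_tr_letters E.
have [s0|s0] := eqVneq s [::].
  move: Lst; rewrite s0 letters_nil; case: t {E} => // i t /setP /(_ i).
  by rewrite !inE eqxx.
have t0 : t != [::].
  apply: contra_neq s0 => t0; move: Lst; rewrite t0 letters_nil.
  by case: s {E lek} => // i s /setP /(_ i); rewrite !inE eqxx.
have [p [a [x spl]]] := lsplit_ex s0; have [y [b [q spr]]] := rsplit_ex s0.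
have [p' [a' [x' spl']]] := lsplit_ex t0; have [y' [b' [q' spr']]] := rsplit_ex t0.
have cp := lsplit_card spl; have cq := lsplit_card spr.
rewrite !letters_rev in cq.
rewrite (wordval_split spl spr) (wordval_split spl' spr').
move: E; rewrite (raw_tr_split spl spr) (raw_tr_split spl' spr') => -[Ep -> -> Eq].
by rewrite (IH p p') // ?(IH q q') // -ltnS -?cp -?cq.
Qed.

Definition treeval (t : tree n) : M := wordval (tree_word t).

Lemma treeval_tr s : treeval (tr s) = wordval s.
Proof. exact/eq_tr_wordval/tree_wordK. Qed.

Lemma treevalM (s t : tree n) : treeval (s * t)%g = treeval s * treeval t.
Proof. by rewrite treeval_tr wordval_cat. Qed.

Lemma treeval1 : treeval 1%g = 1.
Proof. by rewrite -[1%g]tr_nil treeval_tr /wordval big_nil. Qed.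

End Words.

Lemma sqrD x y : x + y = x + y + (x * y + y * x).
Proof. by rewrite -{1}(idem (x + y)) mulrDl !mulrDr !idem [y * x + y]addrC addrACA. Qed.

Lemma addx4 x : x + x + (x + x) = x + x.
Proof. by have := sqrD x x; rewrite idem => <-. Qed.

(** It is [r + 2c = r] and not [r + c = r] that holds for hidden terms: adding
    [c] once may change a parity. *)
Definition absorbs r c := r + c + c = r.

(** If [r = r + z] with [z = c + w], then [r = r + 2z], where [2c] may be
    repeated since [2c = 4c]. *)
Lemma absorbsI r c w : r + c + w = r -> absorbs r c.
Proof.
move=> E; rewrite /absorbs.
have E2 : r + (c + c) + (w + w) = r by rewrite !addrA (ACl (1*2*4*3*5)) /= !E.
by rewrite -addrA -{1}E2 addrAC -(addrA r) addx4 E2.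
Qed.

Lemma absorbsM r x y a b : absorbs r (x * a * y) -> absorbs r (x * b * y) ->
  absorbs r (x * (a * b) * y).
Proof.
set d := x * a * y; set e := x * b * y => Ed Ee; set f := d + e.
have E : f + (x * (a * b) * y + x * (b * a) * y) = f.
  by rewrite /f -!mulrDl -!mulrDr -sqrD.
have Er : r + f + f = r by rewrite /f !addrA (addrAC (r + d)) Ed Ee.
apply: (@absorbsI _ _ (x * (b * a) * y + f + f)).
rewrite -[RHS]Er -[X in _ = _ + X]E !addrA.
by rewrite [RHS](ACl (1*6*7*2*3*4*5)) /=.
Qed.

(** Expanding squares, [u + v = 2u + 2v] and [u + 2v = 3u + 2v]; adding [v] to
    the former gives [u + 2v = 2u + 3v]. *)
Lemma addx3_swap u v : u * v + v * u = u + v -> u + u + u + v + v = u + u + v + v + v.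
Proof.
move=> E; have E1 : u + v = u + v + (u + v) by rewrite {1}sqrD E.
have E2 : u + v + v = u + u + u + v + v.
  rewrite -[LHS]addrA [LHS]sqrD mulrDr mulrDl (addrACA (u * v)) E.
  have -> : u + (v + v) + (u + v + (u + v)) = u + u + u + (v + v + (v + v)).
    by rewrite !addrA [RHS](ACl (1*4*5*2*6*3*7)).
  by rewrite addx4 !addrA.
have E3 : u + u + v + v + v = u + v + v.
  by rewrite [in RHS]E1 !addrA (ACl (1*3*2*4*5)) /=.
by rewrite E3 E2.
Qed.

(** [a] and [a * b] satisfy the hypothesis of [addx3_swap], and so do [a * b]
    and [b]. *)
Lemma absorbs_swap r a b : a * b * a = a -> b * a * b = b ->
  absorbs r a -> absorbs r b -> absorbs r (a * b) -> r + a = r + b.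
Proof.
move=> aba bab; rewrite /absorbs => Ea Eb Eab; set c := a * b.
have Ec : r + a = r + c.
  have /addx3_swap E : a * c + c * a = a + c by rewrite mulrA idem aba addrC.
  rewrite -{1}Ea -{1}Eab.
  have -> : r + a * b + a * b + a + a + a = r + (a + a + a + c + c).
    by rewrite !addrA (ACl (1*4*5*6*2*3)) /=.
  rewrite E !addrA Ea.
  by rewrite -/c in Eab; rewrite Eab.
rewrite Ec; have /addx3_swap E : b * c + c * b = b + c.
  by rewrite mulrA bab -mulrA idem.
rewrite -[in RHS]Eb -[in RHS]Eab.
have -> : r + a * b + a * b + b + b + b = r + (b + b + b + c + c).
  by rewrite !addrA (ACl (1*4*5*6*2*3)) /=.
by rewrite E !addrA Eb; rewrite -/c in Eab; rewrite Eab.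
Qed.
End IdempotentRig.

(** * The free mirig as sums of trees *)

Section FreeMirigSums.
Local Open Scope quotient_scope.
Variable n : nat.
Implicit Types (t : tree n) (l : seq (tree n)) (p q : rig_term n).

Definition rig_class p : free_mirig n :=
  \pi_(free_mirig n) (\pi_(free_rig n) p).

Lemma rig_classD p q : rig_class (RAdd p q) = (rig_class p + rig_class q)%R.
Proof.
rewrite /rig_class -[RHS]/(mirig_add _ _) mirig_addE.
by rewrite -[(_ + _)%R]/(frig_add _ _) frig_addE.
Qed.

Lemma rig_classM p q : rig_class (RMul p q) = (rig_class p * rig_class q)%R.
Proof.
rewrite /rig_class -[RHS]/(mirig_mul _ _) mirig_mulE.
by rewrite -[(_ * _)%R]/(frig_mul _ _) frig_mulE.
Qed.

(** Sums are kept as lists; the laws of rigs and idempotence change the list of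
    a term only up to [indist]. *)
Fixpoint expand p : seq (tree n) :=
  match p with
  | RGen i => [:: tr [:: i]]
  | RZero => [::]
  | ROne => [:: 1%g]
  | RAdd p q => expand p ++ expand q
  | RMul p q => [seq (s * t)%g | s <- expand p, t <- expand q]
  end.

Definition mirig_gen (i : 'I_n) := rig_class (RGen i).
Definition treesum l : free_mirig n := (\sum_(t <- l) treeval mirig_gen t)%R.

Lemma treesum_expand p : treesum (expand p) = rig_class p.
Proof.
have idem := @mirig_mulxx n.
rewrite /treesum; elim: p => [i|||p IHp q IHq|p IHp q IHq] /=.
- by rewrite big_seq1 (treeval_tr idem) /wordval big_seq1.
- by rewrite big_nil.
- by rewrite big_seq1 (treeval1 idem).
- by rewrite big_cat /= IHp IHq rig_classD.
- rewrite rig_classM -IHp -IHq mulr_suml big_allpairs_dep /=.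
  apply: eq_bigr => s _; rewrite mulr_sumr; apply: eq_bigr => t _.
  exact: (treevalM idem).
Qed.

Lemma treesum_surj r : exists l, treesum l = r.
Proof.
elim/quotW: r => r; elim/quotW: r => p; exists (expand p); exact: treesum_expand.
Qed.

Lemma rig_eq_indist p q : rig_eq p q -> indist (expand p) (expand q).
Proof.
elim=> {p q} //=.
- by move=> p q _; apply: indist_sym.
- by move=> p q r _ H1 _; apply: indist_trans H1.
- by move=> p p' q q' _ H1 _ H2; apply: indist_cat.
- by move=> p p' q q' _ H1 _ H2; apply: indist_mul.
- by move=> p q r; rewrite catA.
- by move=> p q; apply: perm_indist; rewrite perm_catC.
- move=> p q r; rewrite [X in indist X _](_ : _ = [seq (s * t)%g |
      s <- [seq (s * t)%g | s <- expand p, t <- expand q], t <- expand r]) //.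
  elim: (expand p) => //= s l ->; rewrite allpairs_cat map_allpairs allpairs_mapl.
  by congr cat; apply: eq_allpairs => ? ?; rewrite mulgA.
- by move=> p; rewrite cats0 (eq_map (@mul1g _)) map_id.
- by move=> p; rewrite allpairs1r (eq_map (@mulg1 _)) map_id.
- by move=> p q r; rewrite allpairs_cat.
- by move=> p q r; apply/perm_indist/permEl/perm_allpairs_catr.
- by move=> p; elim: (expand p).
Qed.

Lemma expand_repr p : indist (expand (repr (\pi_(free_rig n) p))) (expand p).
Proof. exact/rig_eq_indist/repr_pi_rig. Qed.

Lemma mirig_cong_indist (x y : free_rig n) : mirig_cong x y ->
  indist (expand (repr x)) (expand (repr y)).
Proof.
elim=> {x y} //=.
- move=> r; apply: indist_trans (indist_sym (expand_repr (RMul (repr r) (repr r)))).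
  exact: indist_square.
- by move=> x y _; apply: indist_sym.
- by move=> x y z _ H1 _; apply: indist_trans H1.
- move=> x x' y y' _ H1 _ H2.
  apply: indist_trans (expand_repr (RAdd (repr x) (repr y))) _.
  apply: indist_trans (indist_sym (expand_repr (RAdd (repr x') (repr y')))).
  exact: indist_cat.
- move=> x x' y y' _ H1 _ H2.
  apply: indist_trans (expand_repr (RMul (repr x) (repr y))) _.
  apply: indist_trans (indist_sym (expand_repr (RMul (repr x') (repr y')))).
  exact: indist_mul.
Qed.

Lemma expand_surj l : exists p, expand p = l.
Proof.
elim: l => [|t l [p Ep]]; first by exists RZero.
suff [q Eq] : exists q, expand q = [:: t] by exists (RAdd q p); rewrite /= Ep Eq.
rewrite -[t]tree_wordK; elim: (tree_word t) => [|i w [q Eq]].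
  by exists ROne; rewrite tr_nil.
exists (RMul (RGen i) q); rewrite /= Eq /=; congr [:: _].
by rewrite -[i :: w]cat1s tr_cat.
Qed.

(** Each list is the expansion of some term, so an equality of sums is an
    instance of the congruence that defines the free mirig. *)
Theorem eq_treesum_indist l l' : treesum l = treesum l' -> indist l l'.
Proof.
have [[p <-] [q <-]] := (expand_surj l, expand_surj l').
rewrite !treesum_expand => /mirig_congP /mirig_cong_indist H.
apply: indist_trans (indist_sym (expand_repr p)) _.
exact: indist_trans H (expand_repr q).
Qed.

End FreeMirigSums.

(** * The triple of a sum *)

Section TripleOfList.
Local Open Scope group_scope.
Variable n : nat.
Implicit Types (s t u d : tree n) (R : set (tree n)) (l : seq (tree n)).

(** The component [D]: the terms that are alone below their alphabet. *)
Definition single_part l : set (tree n) := [set t | below (alpha t) l = [:: t]].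

(** The component [S]: the least replete set containing the products of distinct
    terms. *)
Definition stable_part l : set (tree n) :=
  [set t | forall R, replete R -> pairwise (orth R) l -> R t].

Definition parity_part l : {ffun {set 'I_n} -> bool} :=
  [ffun A => odd (count (pred1 A \o @alpha n) l)].

Definition triple_of l := (stable_part l, single_part l, parity_part l).

Lemma indist_triple l l' : indist l l' -> triple_of l = triple_of l'.
Proof.
case=> H1 H2 H3; congr (_, _, _).
- by apply/seteqP; split=> t Ht R Rr G; apply: Ht => //; move: G; rewrite H1.
- apply/seteqP; split=> t /= /sole_single E; apply/sole_single; by rewrite -E H2.
- by apply/ffunP=> A; rewrite !ffunE H3.
Qed.

Lemma stable_replete l : replete (stable_part l).
Proof.
apply/repleteP => x y s t Hs Ht R Rr G; have /repleteP Rc := Rr.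
by apply: Rc; [apply: Hs | apply: Ht].
Qed.

Lemma orth_stable l : pairwise (orth (stable_part l)) l.
Proof.
apply/pairwise_symP => [|s t sl tl st]; first exact: orth_sym.
by apply/orthP; split=> R Rr /pairwise_symP /(_ s t sl tl st)
  => /(_ (@orth_sym _ R)) /orthP [].
Qed.

Lemma orth_stable_mem l s t : s \in l -> t \in l -> (s = t -> 1 < count_mem s l) ->
  orth (stable_part l) s t.
Proof.
by have /pairwise_symP H := orth_stable l; apply: H; apply: orth_sym.
Qed.

Lemma mem_parts l t : t \in l -> single_part l t \/ stable_part l t.
Proof.
move=> tl; have [|[s sl [st cs]]] := single_below tl; [by left | right].
apply: (orth_doubled (stable_replete l) _ st); apply: orth_stable_mem => //.
by move=> E; rewrite E; apply: cs.
Qed.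

Lemma single_mem l t : single_part l t -> t \in l.
Proof. exact: below_single_mem. Qed.

Lemma single_count l t : single_part l t -> count_mem t l = 1%N.
Proof.
move=> St; apply/eqP; rewrite eqn_leq -has_count has_pred1 (single_mem St) andbT.
rewrite -[X in _ <= X]/(size [:: t]) -St size_filter.
by apply: sub_count => u /= /eqP ->.
Qed.

Lemma single_sub l s t : s \in l -> single_part l t -> alpha s \subset alpha t -> s = t.
Proof.
move=> sl St st; have: s \in below (alpha t) l by rewrite mem_filter st.
by rewrite St inE => /eqP.
Qed.

(** The trees whose alphabet is not contained in that of [t] form a replete set,
    and it contains the product of any two distinct terms because [t] is the
    only term below its alphabet. *)
Lemma stable_not_below l t u : single_part l t -> stable_part l u ->
  ~~ (alpha u \subset alpha t).
Proof.
move=> St; pose R := [set u | ~~ (alpha u \subset alpha t)].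
have Rr : replete R.
  apply/repleteP => x y s s'; rewrite /R /= !alphaM !subUset.
  by do !case: (_ \subset _).
move/(_ R Rr); apply; apply/pairwise_symP => [|s s' sl sl' ss']; first exact: orth_sym.
have sub : ~~ (alpha s :|: alpha s' \subset alpha t).
  rewrite subUset; apply/negP => /andP [/(single_sub sl St) Es /(single_sub sl' St) Es'].
  by have := ss'; rewrite Es Es' (single_count St) => /(_ erefl).
by apply/orthP; rewrite /R /= !alphaM [alpha s' :|: _]setUC.
Qed.

Lemma single_orth_mem l R d s : pairwise (orth R) l ->
  single_part l d -> s \in l -> d = s \/ orth R d s.
Proof.
move=> /pairwise_symP G Sd sl; have [->|ds] := eqVneq d s; [by left | right].
apply: G => //; [exact: orth_sym | exact: single_mem |].
by move=> E; rewrite E eqxx in ds.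
Qed.

(** The trees orthogonal to [d] form a replete set; it contains the product of
    two distinct terms [s] and [t] even if [d] is one of them. *)
Lemma single_orth_stable l d u : single_part l d -> stable_part l u ->
  orth (stable_part l) d u.
Proof.
move=> Sd Su.
suff H R : replete R -> pairwise (orth R) l -> orth R d u.
  by apply/orthP; split=> R Rr /(H R Rr) /orthP [].
move=> Rr G; have := Su _ (replete_orth1 d Rr); apply.
apply/pairwise_symP; first exact: orth_sym.
have main s t : s \in l -> t \in l -> (s = t -> 1 < count_mem s l) ->
    orth R d (s * t).
  move=> sl tl st; have := @orth_mulc n R 1 1 d s t Rr; rewrite !mul1g !mulg1.
  apply; try exact: (single_orth_mem G Sd).
  by move/pairwise_symP: G; apply=> //; apply: orth_sym.
move=> s t sl tl st; apply/orthP; split; apply: main => // E.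
by rewrite E; apply: st; rewrite E.
Qed.

Lemma single_orth l d d' : single_part l d -> single_part l d' -> d <> d' ->
  orth (stable_part l) d d'.
Proof.
by move=> Sd Sd' dd'; apply: orth_stable_mem => //; apply: single_mem.
Qed.

Lemma triple_of_complementary l : complementary_triples n (triple_of l).
Proof.
have sub_part u : (single_part l `|` stable_part l) u ->
    forall t, single_part l t -> alpha u \subset alpha t -> u = t.
  move=> [Su|Su] t St ut; first exact: single_sub (single_mem Su) St ut.
  by have := stable_not_below St Su; rewrite ut.
split.
- exact: stable_replete.
- by move=> s t Ss St; apply: sub_part => //; left.
- split.
  + apply/seteqP; split=> // A [[t St <-] [u Su Eu]].
    by have := stable_not_below St Su; rewrite Eu subxx.
  + move=> s t [Ss|Ss] [St|St].
    * have [<-|st] := eqVneq s t; first by left; rewrite treexx.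
      by right; have /orthP [] : orth (stable_part l) s t
        by apply: single_orth => //; apply/eqP.
    * by right; have /orthP [] := single_orth_stable Ss St.
    * by right; have /orthP [] := single_orth_stable St Ss.
    * by right; have sr := stable_replete l; apply: (repleteM sr).
  + by move=> t A St [u Su <-] ut; rewrite (sub_part u Su t St ut).
- split=> [A [t St <-]|A]; rewrite ffunE.
    rewrite (_ : count _ l = 1%N) // -(single_count St).
    apply: eq_in_count => u ul /=; apply/eqP/eqP => [E|->//].
    by apply: (single_sub ul St); rewrite E.
  move=> c; have /hasP [t tl /eqP <-] : has (pred1 A \o @alpha n) l.
    by rewrite has_count; case: count c.
  by exists t => //; case: (mem_parts tl); [right | left].
Qed.

End TripleOfList.

Section Injectivity.
Local Open Scope ring_scope.
Variable n : nat.
Implicit Types (s t : tree n) (S : set (tree n)) (l w : seq (tree n)) (r : free_mirig n).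
Let idem := @mirig_mulxx n.
Let tval t := treeval (@mirig_gen n) t.

Definition absorbed r : set (tree n) := [set t | absorbs r (tval t)].

Lemma absorbed_replete r : replete (absorbed r).
Proof.
apply/repleteP => x y s t; rewrite /absorbed /= /tval !(treevalM idem).
exact: absorbsM.
Qed.

(** The remainder [r] is what the induction on [l] needs, to keep the terms
    already removed from [l]. *)
Lemma orth_absorbed r l : pairwise (orth (absorbed (treesum l + r))) l.
Proof.
elim: l r => // t l IH r /=.
have E : treesum (t :: l) + r = treesum l + (tval t + r).
  by rewrite /treesum big_cons [RHS]addrCA addrA.
rewrite E IH andbT; apply/allP => s sl.
have [r1 Er] : exists r1, treesum l + (tval t + r) = tval t + tval s + r1.
  exists (treesum (rem s l) + r); rewrite /treesum (big_rem s) //= -/(tval s).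
  by rewrite !addrA (ACl (3*1*2*4)).
have Et : tval t + tval s + r1 + (tval t * tval s + tval s * tval t) =
    tval t + tval s + r1.
  by rewrite addrAC -(sqrD idem).
apply/orthP; rewrite /absorbed /= Er /tval !(treevalM idem).
split; apply: (absorbsI idem).
  by rewrite addrA in Et; exact: Et.
by rewrite addrAC; rewrite addrA in Et; exact: Et.
Qed.

Lemma stable_absorbed l t : stable_part l t -> absorbs (treesum l) (tval t).
Proof.
move=> St; apply: (St (absorbed (treesum l))); first exact: absorbed_replete.
by have := orth_absorbed 0 l; rewrite addr0.
Qed.

(** Some other term [b] of [w] has the alphabet of its first term [a], and
    [r + a + b = r + b + b = r]. *)
Lemma absorbs_even r S w : replete S -> (forall t, S t -> absorbs r (tval t)) ->
    {in w, forall t, S t} ->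
    (forall A, ~~ odd (count (pred1 A \o @alpha n) w)) ->
  r + treesum w = r.
Proof.
move=> Sr Sa; have [k] := ubnP (size w); elim: k w => // k IH [|a w] lek Sw ev.
  by rewrite /treesum big_nil addr0.
have : has (pred1 (alpha a) \o @alpha n) w.
  rewrite has_count; have := ev (alpha a); rewrite /= eqxx /= negbK.
  by case: count.
case/hasP => b bw /= /eqP Eab.
have [Sa' Sb] : S a /\ S b by split; apply: Sw; rewrite inE ?eqxx ?bw ?orbT.
have Eba : r + tval a = r + tval b.
  apply: (absorbs_swap idem); try exact: Sa.
  - by rewrite /tval -!(treevalM idem) treeMKM ?Eab.
  - by rewrite /tval -!(treevalM idem) treeMKM ?Eab.
  - by rewrite /tval -(treevalM idem); apply: Sa; apply: repleteM.
rewrite /treesum big_cons (big_rem b) //= -/(tval a) -/(tval b) !addrA Eba.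
rewrite (Sa b Sb); apply: IH.
- by rewrite size_rem //; case: (w) bw lek => //= ? ? _ /ltnW.
- by move=> t /mem_rem tw; apply: Sw; rewrite inE tw orbT.
- move=> A; have := ev A; rewrite /= (permP (perm_to_rem bw)) /= -Eab !oddD.
  by rewrite addKb.
Qed.

(** Write [l = d + k] and [l' = d + k'] with [d] the common part in [D] and [k],
    [k'] in [S]. As [k + k'] and [k + k] have even counts,
    [l = l + k + k' = d + 2k + k' = l' + 2k = l']. *)
Lemma triple_of_inj l l' : triple_of l = triple_of l' -> treesum l = treesum l'.
Proof.
case=> ES ED Ep; pose D t := `[< single_part l t >].
pose k := [seq t <- l | ~~ D t]; pose k' := [seq t <- l' | ~~ D t].
have DP t : reflect (single_part l t) (D t) := asboolP _.
have DP' t : reflect (single_part l' t) (D t) by rewrite -ED.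
have perm_d : perm_eq (filter D l) (filter D l').
  apply/allP => t _ /=; rewrite !count_filter.
  have [Dt|Dt] := boolP (D t); last first.
    rewrite !(@eq_count _ _ pred0) ?count_pred0 // => u /=;
    by apply/andP => -[/eqP -> ]; rewrite (negPf Dt).
  have cE m : count (predI (pred1 t) D) m = count_mem t m.
    by apply: eq_count => u /=; case: eqP => // ->; rewrite Dt.
  by rewrite !cE (single_count (DP t Dt)) (single_count (DP' t Dt)).
pose d := treesum (filter D l).
have El : treesum l = d + treesum k.
  rewrite /treesum -big_cat /=; apply/perm_big.
  by rewrite perm_sym (permEl (perm_filterC _ _)).
have El' : treesum l' = d + treesum k'.
  rewrite /d [X in X + _](perm_big (filter D l')) // -big_cat /=.
  by apply/perm_big; rewrite perm_sym (permEl (perm_filterC _ _)).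
have kS : {in k, forall t, stable_part l t}.
  by move=> t; rewrite mem_filter => /andP [/DP nD /mem_parts [/nD|]].
have kS' : {in k', forall t, stable_part l t}.
  by move=> t; rewrite mem_filter ES => /andP [/DP' nD /mem_parts [/nD|]].
have ev A : odd (count (pred1 A \o @alpha n) k) = odd (count (pred1 A \o @alpha n) k').
  have split m (P : pred (tree n)) :
      count P m = (count P (filter D m) + count P [seq t <- m | ~~ D t])%N.
    by rewrite -(permP (permEl (perm_filterC D m))) count_cat.
  have /ffunP /(_ A) := Ep; rewrite !ffunE (split l) (split l') !oddD (permP perm_d).
  exact: addbI.
have abs w : {in w, forall t, stable_part l t} ->
    (forall A, ~~ odd (count (pred1 A \o @alpha n) w)) ->
  treesum l + treesum w = treesum l.
  apply: absorbs_even; [exact: stable_replete | exact: stable_absorbed].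
have abs' w : {in w, forall t, stable_part l t} ->
    (forall A, ~~ odd (count (pred1 A \o @alpha n) w)) ->
  treesum l' + treesum w = treesum l'.
  rewrite ES; apply: absorbs_even; [exact: stable_replete | exact: stable_absorbed].
have mix : treesum l + treesum (k ++ k') = treesum l.
  apply: abs => [t|A]; first by rewrite mem_cat => /orP [/kS|/kS'].
  by rewrite count_cat oddD ev addbb.
have dbl : treesum l' + treesum (k ++ k) = treesum l'.
  apply: abs' => [t|A]; first by rewrite mem_cat => /orP [/kS|/kS].
  by rewrite count_cat oddD addbb.
rewrite -mix -dbl El El' /treesum !big_cat /= !addrA.
by rewrite [LHS](ACl (1*4*2*3)).
Qed.

End Injectivity.

(** * Realizing every triple *)

Section Surjectivity.
Local Open Scope group_scope.
Variable n : nat.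
Implicit Types (s t u d : tree n) (R S D : set (tree n)).
Implicit Types (p : {ffun {set 'I_n} -> bool}) (A : {set 'I_n}).

(** Each child of a node has one letter less than the node. *)
Lemma raw_trees_finite k : exists l : seq (raw_tree n),
  forall t : raw_tree n, is_tree t -> #|raw_alpha t| <= k -> t \in l.
Proof.
elim: k => [|k [l Hl]].
  exists [:: Leaf] => -[|t0 a0 a1 t1] //=; first by rewrite inE.
  by case/and5P=> _ _ ta _ _; rewrite cardsU1 ta.
pose node (x : raw_tree n * 'I_n * ('I_n * raw_tree n)) := Node x.1.1 x.1.2 x.2.1 x.2.2.
pose I := enum 'I_n; exists (Leaf :: [seq node x |
  x <- [seq (x, y) | x <- [seq (x, a) | x <- l, a <- I],
                     y <- [seq (a, x) | a <- I, x <- l]]]).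
case=> [_ _|t0 a0 a1 t1 /= /and5P [T0 T1 ta0 ta1 /eqP E] le]; rewrite inE ?eqxx //.
apply/orP; right; apply/mapP; exists ((t0, a0), (a1, t1)) => //.
have le0 : #|raw_alpha t0| <= k by move: le; rewrite cardsU1 ta0.
have le1 : #|raw_alpha t1| <= k by move: le; rewrite E cardsU1 ta1.
by do 2?apply: allpairs_f; rewrite ?mem_enum //; apply: Hl.
Qed.

Lemma trees_finite : exists l : seq (tree n), forall t, t \in l.
Proof.
have [l Hl] := raw_trees_finite n.
exists (pmap insub l) => t; rewrite mem_pmap; apply/mapP; exists (rtree t).
  by apply: Hl; [exact: (valP t) | rewrite -[X in _ <= X]card_ord max_card].
by rewrite valK.
Qed.

Lemma set_enum S : exists2 l : seq (tree n), uniq l & forall t, (t \in l) = `[< S t >].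
Proof.
have [l Hl] := trees_finite; exists [seq t <- undup l | `[< S t >]].
  exact/filter_uniq/undup_uniq.
by move=> t; rewrite mem_filter mem_undup Hl andbT.
Qed.

(** One tree of [S] for each alphabet selected by [p]. *)
Lemma alpha_transversal S p : (forall A, p A -> alpha_bar S A) ->
  exists2 w : seq (tree n), {in w, forall t, S t} &
    forall A, count (pred1 A \o @alpha n) w = p A :> nat.
Proof.
move=> pS; pose rho A := xget 1 [set t | S t /\ alpha t = A].
have rhoP A : p A -> S (rho A) /\ alpha (rho A) = A.
  move/pS => [t St Et]; apply: (@xgetPex _ 1 [set t | S t /\ alpha t = A]).
  by exists t.
exists [seq rho A | A <- enum {set 'I_n} & p A].
  by move=> t /mapP [A]; rewrite mem_filter => /andP [/rhoP [SA _] _] ->.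
move=> A; rewrite count_map -[p A : nat]/(nat_of_bool _).
rewrite (@eq_in_count _ _ (pred1 A)).
  rewrite count_uniq_mem; last exact/filter_uniq/enum_uniq.
  by rewrite mem_filter mem_enum andbT.
by move=> B; rewrite mem_filter => /andP [/rhoP [_ /= ->]].
Qed.

Lemma triple_of_surj T : complementary_triples n T -> exists l, triple_of l = T.
Proof.
case: T => -[S D] p [Sr spD [DS0 DSM Dmin] [pD pDS]].
have disj d u : D d -> S u -> ~~ (alpha u \subset alpha d).
  move=> Dd Su; apply/negP => ud.
  have Eud : alpha u = alpha d by apply: (Dmin d) => //; exists u => //; right.
  have : (alpha_bar D `&` alpha_bar S) (alpha d) by split; [exists d | exists u].
  by rewrite DS0.
have DNS d : D d -> ~ S d by move=> Dd Sd; have := disj d d Dd Sd; rewrite subxx.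
(* By sparsity a product that is still in D equals each of its factors in D;
   this contradicts disj, or below the distinctness of the two factors. *)
have orthDS d u : D d -> S u -> orth S d u.
  move=> Dd Su; apply/orthP; split.
    have [Ddu|//] : (D `|` S) (d * u) by apply: DSM; [left | right].
    have E : d = d * u by apply: spD => //; rewrite alphaM subsetUl.
    by have := disj d u Dd Su; rewrite E alphaM subsetUr.
  have [Ddu|//] : (D `|` S) (u * d) by apply: DSM; [right | left].
  have E : d = u * d by apply: spD => //; rewrite alphaM subsetUr.
  by have := disj d u Dd Su; rewrite E alphaM subsetUl.
have mulDD d d' : D d -> D d' -> d <> d' -> S (d * d').
  move=> Dd Dd' dd'; have [H|//] : (D `|` S) (d * d') by apply: DSM; left.
  case: dd'; have -> : d = d * d' by apply: spD => //; rewrite alphaM subsetUl.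
  by apply/esym/spD => //; rewrite alphaM subsetUr.
have [ld ld_uniq ldE] := set_enum D; have [ls ls_uniq lsE] := set_enum S.
pose p' := [ffun A => p A && ~~ `[< alpha_bar D A >]].
have [w wS wA] : exists2 w : seq (tree n), {in w, forall t, S t} &
    forall A, count (pred1 A \o @alpha n) w = p' A :> nat.
  apply: alpha_transversal => A; rewrite ffunE => /andP [/pDS [t [St|Dt] <-] nD].
    by exists t.
  by case/negP: nD; apply/asboolP; exists t.
(* Listing S twice makes each of its trees a product of two distinct terms. *)
pose l := ld ++ ls ++ ls ++ w; exists l.
have mem_l t : t \in l -> D t \/ S t.
  rewrite !mem_cat ldE lsE => /or4P [/asboolP|/asboolP|/asboolP|/wS];
    by [left | right].
have countD d : D d -> count_mem d l = 1%N.
  move=> Dd; rewrite !count_cat (count_uniq_mem _ ld_uniq).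
  rewrite !(count_uniq_mem _ ls_uniq) ldE lsE.
  have -> : `[< D d >] by exact/asboolP.
  have /negPf -> : ~~ `[< S d >] by apply/asboolPn/DNS.
  by rewrite (count_memPn _) //; apply/negP => /wS; apply: DNS.
have countS u : S u -> 1 < count_mem u l.
  move=> Su; rewrite !count_cat (count_uniq_mem _ ld_uniq).
  rewrite !(count_uniq_mem _ ls_uniq) ldE lsE.
  by have -> : `[< S u >] by [exact/asboolP]; case: asbool.
have lD t : single_part l t <-> D t.
  split=> [St|Dt].
    case: (mem_l t (single_mem St)) => // /countS.
    by rewrite (single_count St).
  rewrite /single_part /=; have -> : below (alpha t) l = filter (pred1 t) l.
    apply: eq_in_filter => u ul /=; apply/idP/eqP => [ut|-> //].
    by case: (mem_l u ul) => [Du|/(disj t u Dt)]; [apply: spD | rewrite ut].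
  by have /all_pred1P -> := filter_all (pred1 t) l; rewrite size_filter countD.
have lS t : stable_part l t <-> S t.
  split=> [|St R Rr /pairwise_symP G]; last first.
    have tl : t \in l by rewrite -has_pred1 has_count (ltn_trans _ (countS t St)).
    have /orthP [] : orth R t t.
      by apply: G => //; [exact: orth_sym | move=> _; exact: countS].
    by rewrite treexx.
  apply => //; apply/pairwise_symP => [|s u sl ul su]; first exact: orth_sym.
  have [[Ds|Ss] [Du|Su]] := (mem_l s sl, mem_l u ul).
  - have su' : s <> u by move/su; rewrite countD.
    by apply/orthP; split; apply: mulDD => //; apply: nesym.
  - exact: orthDS.
  - by rewrite orth_sym; apply: orthDS.
  - exact: orth_mem.
congr (_, _, _).
- by apply/seteqP; split=> t /lS.
- by apply/seteqP; split=> t /lD.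
apply/ffunP => A; rewrite ffunE !count_cat wA !oddD addKb ffunE oddb.
have [[d Dd Ed]|nD] := asboolP (alpha_bar D A); last first.
  rewrite andbT (@eq_in_count _ _ pred0) ?count_pred0 // => t.
  by rewrite ldE => /asboolP Dt /=; apply/eqP => E; apply: nD; exists t.
rewrite andbF addbF pD; last by exists d.
rewrite (@eq_in_count _ _ (pred1 d)) ?count_uniq_mem // ?ldE.
  by have -> : `[< D d >] by exact/asboolP.
move=> t; rewrite ldE => /asboolP Dt /=; apply/eqP/eqP => [E|-> //].
by apply: spD => //; rewrite E Ed.
Qed.

End Surjectivity.

(** A triple is sent to the sum of any list that realizes it; all such lists
    have the same sum. *)
Theorem theorem4p29 (n : nat) :
  exists f : set (tree n) * set (tree n) * {ffun {set 'I_n} -> bool} ->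
             free_mirig n,
    set_bij (complementary_triples n) [set: free_mirig n] f.
Proof.
have sec T : exists r, complementary_triples n T ->
    exists2 l, treesum l = r & triple_of l = T.
  have [/triple_of_surj [l lT]|nT] := pselect (complementary_triples n T).
    by exists (treesum l) => _; exists l.
  by exists (treesum [::]).
have [f fP] := choice sec; exists f; split=> //.
- move=> T T' /set_mem /fP [l Ef lT] /set_mem /fP [l' Ef' lT'] E.
  by rewrite -lT -lT'; apply/indist_triple/eq_treesum_indist; rewrite Ef Ef'.
move=> r _; have [l <-] := treesum_surj r.
have Tl := triple_of_complementary l; exists (triple_of l) => //.
by have [l' <-] := fP _ Tl; apply: triple_of_inj.
Qed.
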